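(* Let $G=(V,E)$ be a (finite or infinite) non-bipartite, simple, connected, vertex-transitive graph with degree $d<\infty$. For each $x\in V$, $c\in(0,1)$ and $\delta\in(0,2]$, $$\mu_x^{\mathcal Q}(\delta)\le\frac{1}{c^2\,N^{\#}\!\left(\frac{\sqrt{1-c}}{\sqrt{d\,\delta}}\right)},$$ where $N^{\#}(r)$ denotes the number of vertices in a ball of radius $r$. In addition, if $G$ is finite, then $$\lambda_{\min}^{\mathcal Q}\ge\frac2d\left(\sin\frac{\pi}{4(\mathrm{diam}(G)+1)}\right)^2.$$
   Context: Graphs are undirected and unweighted. A graph is vertex-transitive if its automorphism group acts transitively on vertices. $N^{\#}(r)=|\{v\in V:\mathrm{dist}(v,x)\le r\}|$ for real $r\ge0$, independent of $x$; $\mathrm{diam}(G)$ is the graph diameter; here $\pi$ is the usual number. $\ell^2(V,d)$ is the Hilbert space of functions on $V$ with $\langle f,g\rangle_d=\sum_x d\,f(x)\overline{g(x)}$. The transition operator is $(Pf)(x)=\frac1{d}\sum_{y\sim x}f(y)$, bounded self-adjoint on $\ell^2(V,d)$; $\mathcal Q=I+P$. With $I_{\mathcal Q}$ the spectral projection-valued measure of $\mathcal Q$ and $\mathbf e_x=\mathbf 1_x/\sqrt d$, the vertex spectral measure is $\mu_x^{\mathcal Q}(\delta)=\langle I_{\mathcal Q}([0,\delta])\mathbf e_x,\mathbf e_x\rangle_d$. For finite $G$, $\lambda_{\min}^{\mathcal Q}$ is the smallest eigenvalue of $\mathcal Q$. *)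

(* Defs.v *)
From HB Require Import structures.
From mathcomp Require Import all_boot all_order all_algebra.
From mathcomp Require Import finmap.
From mathcomp Require Import all_classical all_reals all_analysis.
From mathcomp Require Import complex.

Set Implicit Arguments.
Unset Strict Implicit.
Unset Printing Implicit Defensive.

Import Order.TTheory GRing.Theory Num.Theory.
Import numFieldNormedType.Exports.

Local Open Scope classical_set_scope.
Local Open Scope ring_scope.

(* A simple graph on V is a symmetric irreflexive relation e : rel V; V is any
   choiceType, hence finite or infinite. *)
Section Graph.
Variables (V : choiceType) (e : rel V).

Definition simple_graph : Prop := symmetric e /\ irreflexive e.

Definition walk (n : nat) (x y : V) : Prop :=
  exists p : seq V, [/\ path e x p, last x p = y & size p = n].

Definition connected_graph : Prop := forall x y : V, exists n, walk n x y.

Definition graph_automorphism (phi : V -> V) : Prop :=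
  bijective phi /\ forall x y, e (phi x) (phi y) = e x y.

Definition vertex_transitive : Prop :=
  forall x y : V, exists2 phi, graph_automorphism phi & phi x = y.

Definition regular_graph (d : nat) : Prop :=
  forall x : V, ([set y | e x y] #= `I_d)%card.

Definition bipartite_graph : Prop :=
  exists side : V -> bool, forall x y, e x y -> side x != side y.

(* Graph distance: the least length of a walk (junk value 0 if there is none,
   which does not happen in a connected graph). *)
Definition dist (x y : V) : nat :=
  match pselect (exists n, `[< walk n x y >]) with
  | left xy => ex_minn xy
  | right _ => 0%N
  end.

(* N^#(r), for the ball centred at x; the balls of a locally finite graph are
   finite, so fset_set takes no default value here. *)
Definition ball_card (R : realType) (x : V) (r : R) : nat :=
  #|` fset_set [set v | (dist v x)%:R <= r] |.

(* The diameter; meaningful when distances are bounded, in particular when V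
   is finite. *)
Definition diam (R : realType) : R :=
  sup [set (dist p.1 p.2)%:R | p in [set: V * V]].

End Graph.

Section L2.
Variables (R : realType) (V : choiceType).

(* Unordered (absolutely convergent) sums over V. *)
Definition rsum (g : V -> R) : R :=
  fine (\esum_(x in [set: V]) (EFin \o g)^\+ x
        - \esum_(x in [set: V]) (EFin \o g)^\- x)%E.

Definition csum (g : V -> R[i]) : R[i] :=
  Complex (rsum (fun x => complex.Re (g x))) (rsum (fun x => complex.Im (g x))).

(* The Hilbert space l^2(V, d) is the set of functions satisfying [l2 d]:
   the sum of d |f(x)|^2 is finite. *)
Definition l2 (d : nat) (f : V -> R[i]) : Prop :=
  (\esum_(x in [set: V])
     (d%:R * (complex.Re (f x) ^+ 2 + complex.Im (f x) ^+ 2))%:E < +oo)%E.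

Definition inner (d : nat) (f g : V -> R[i]) : R[i] :=
  csum (fun x => d%:R * f x * (g x)^*).

Definition unit_vertex (d : nat) (x : V) : V -> R[i] :=
  fun y => if y == x then ((Num.sqrt (d%:R : R))^-1)%:C%C else 0.

(* Operators on l^2(V, d) are functions (V -> R[i]) -> (V -> R[i]), of which
   only the restriction to l2 matters; the same holds for the values of a
   projection-valued measure at non-measurable sets. *)
Local Notation operator := ((V -> R[i]) -> V -> R[i]).

(* A resolution of the identity on the Borel sets of R. Countable additivity is
   that of the scalar measures A |-> <E(A) f, f>, which are real because E(A)
   is self-adjoint; additivity of E follows by polarization. *)
Definition scalar_measure (d : nat) (E : set R -> operator) (f : V -> R[i])
    (m : {measure set (measurableTypeR R) -> \bar R}) : Prop :=
  forall A : set (measurableTypeR R), measurable A ->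
    m A = (complex.Re (inner d (E A f) f))%:E.

Record projection_valued_measure (d : nat) (E : set R -> operator) : Prop := {
  pvm_l2 : forall (A : set (measurableTypeR R)) f,
    measurable A -> l2 d f -> l2 d (E A f);
  pvm_linear : forall (A : set (measurableTypeR R)) (a : R[i]) f g,
    measurable A -> l2 d f -> l2 d g ->
    E A (fun x => a * f x + g x) = (fun x => a * E A f x + E A g x);
  pvm_selfadjoint : forall (A : set (measurableTypeR R)) f g,
    measurable A -> l2 d f -> l2 d g -> inner d (E A f) g = inner d f (E A g);
  pvm_setI : forall (A B : set (measurableTypeR R)) f,
    measurable A -> measurable B -> l2 d f -> E (A `&` B) f = E A (E B f);
  pvm_setT : forall f, l2 d f -> E setT f = f;
  pvm_sigma_additive : forall f, l2 d f -> exists m, scalar_measure d E f m }.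

(* E is the spectral projection-valued measure of the self-adjoint operator T,
   i.e. T is the integral of lambda dE(lambda), in the weak sense. By the
   spectral theorem there is exactly one such E (on l2 and Borel sets) when T
   is bounded and self-adjoint. *)
Definition spectral_measure_of (d : nat) (T : operator) (E : set R -> operator)
    : Prop :=
  projection_valued_measure d E /\
  forall f m, l2 d f -> scalar_measure d E f m ->
    m.-integrable [set: measurableTypeR R] (fun t => t%:E) /\
    inner d (T f) f =
      (fine (\int[m]_(t in [set: measurableTypeR R]) t%:E))%:C%C.

(* mu_x(delta), E being the spectral measure. The inner product is real. *)
Definition vertex_spectral_measure (d : nat) (E : set R -> operator)
    (x : V) (delta : R) : R :=
  complex.Re
    (inner d (E [set` `[0, delta]] (unit_vertex d x)) (unit_vertex d x)).

Definition eigenvalues (d : nat) (T : operator) : set R :=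
  [set lam | exists f : V -> R[i],
    [/\ l2 d f, f <> (fun=> 0) & T f = (fun x => lam%:C%C * f x)]].

Definition smallest_eigenvalue (d : nat) (T : operator) (lam : R) : Prop :=
  eigenvalues d T lam /\ lbound (eigenvalues d T) lam.

Definition transition_op (e : rel V) (d : nat) : operator :=
  fun f x => (d%:R)^-1 * \sum_(y \in [set y | e x y]) f y.

Definition Qop (e : rel V) (d : nat) : operator :=
  fun f x => f x + transition_op e d f x.

End L2.

(* Main.v *)
(* Part 1. Put F x = E([0,delta]) e_x in l^2(V, d). Automorphisms preserve
   mu = |F x|^2, and the sum of |F x + F y|^2 over the neighbours y of x is
   2 d <Q (F x), F x> <= 2 d delta mu, so |F x + F y|^2 <= 2 d delta mu along
   every edge. Walking k edges gives |<F x, F v>| >= mu (1 - k^2 d delta), which is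
   at least c mu on the ball of the statement; as <F x, F v> = <F x, e_v>,
   Bessel's inequality yields c^2 mu^2 N <= mu.

   That E([0,delta]) is compatible with an automorphism U uses no uniqueness of
   spectral measures: for b > delta the operator X = E(]b,oo[) U restricted to
   the range of E([0,delta]) satisfies b^n |X f| <= |Q^n X f| = |X Q^n f| <=
   delta^n |f|, hence vanishes.

   Part 2. Averaging an eigenfunction over the automorphism group gives vectors
   F x of constant norm, and the angle between F x and - F y is at most theta for
   each edge, where cos theta = 1 - d lambda. A non-bipartite graph has an odd
   closed walk of length at most 2 diam + 1; along it F x is turned into - F x, so
   (2 diam + 1) theta >= pi. *)
Require Import Defs.
From HB Require Import structures.
From mathcomp Require Import all_boot all_order all_fingroup all_algebra.
From mathcomp Require Import finmap.
From mathcomp Require Import all_classical all_reals all_analysis.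
From mathcomp Require Import complex ring lra.

Set Implicit Arguments.
Unset Strict Implicit.
Unset Printing Implicit Defensive.

Import Order.TTheory GRing.Theory Num.Theory.
Import numFieldNormedType.Exports.

Local Open Scope classical_set_scope.
Local Open Scope ring_scope.

(** * Measures and inner products *)

Lemma ler_cos (R : realType) (x y : R) :
  0 <= x <= pi -> 0 <= y <= pi -> (cos x <= cos y) = (y <= x).
Proof. by move=> x0 y0; rewrite !leNgt ltr_cos. Qed.

Section ConcentratedMeasure.
Variables (R : realType) (m : {measure set (measurableTypeR R) -> \bar R}).
Hypothesis m_fin : (m setT < +oo)%E.
Hypothesis id_int : m.-integrable [set: measurableTypeR R] (fun t => t%:E).

Lemma integrable_cst_finite (A : set (measurableTypeR R)) (a : R) :
  measurable A -> m.-integrable A (fun=> a%:E).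
Proof.
move=> mA; apply/integrableP; split; first exact: measurable_cst.
rewrite (integral_cst m mA) lte_mul_pinfty //.
by apply: le_lt_trans m_fin; apply: le_measure; rewrite ?inE.
Qed.

Lemma integral_concentrated (A : set (measurableTypeR R)) :
  measurable A -> m (~` A) = 0%E ->
  (\int[m]_(t in [set: measurableTypeR R]) t%:E = \int[m]_(t in A) t%:E)%E.
Proof.
move=> mA mA0; have mAC := measurableC mA.
by rewrite (negligible_integral mAC measurableT id_int mA0) setTD setCK.
Qed.

Lemma measure_concentrated (A : set (measurableTypeR R)) :
  measurable A -> m (~` A) = 0%E -> m A = m setT.
Proof.
move=> mA mA0; have := measureU m mA (measurableC mA) (setICr A).
by rewrite setUv => ->; rewrite [X in (_ + X)%E]mA0 adde0.
Qed.

(** The complement of [A] is null, so the integral and the total mass may both be computed on [A],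
    where the integrand is at most [a]. *)
Lemma integral_id_le (A : set (measurableTypeR R)) (a : R) :
  measurable A -> m (~` A) = 0%E -> (forall t, A t -> t <= a) ->
  fine (\int[m]_(t in [set: measurableTypeR R]) t%:E) <= a * fine (m setT).
Proof.
move=> mA mA0 Aa.
have fT : m setT \is a fin_num by rewrite ge0_fin_numE.
rewrite -[a]/(fine a%:E) -fineM // fine_le //.
- exact: integrable_fin_num.
- by rewrite fin_numM.
rewrite (integral_concentrated mA mA0) -(measure_concentrated mA mA0).
rewrite -(integral_cst m mA a%:E); apply: le_integral => //.
- exact: (integrableS measurableT).
- exact: integrable_cst_finite.
by move=> t; rewrite inE => /Aa; rewrite lee_fin.
Qed.

Lemma integral_id_ge (A : set (measurableTypeR R)) (a : R) :
  measurable A -> m (~` A) = 0%E -> (forall t, A t -> a <= t) ->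
  a * fine (m setT) <= fine (\int[m]_(t in [set: measurableTypeR R]) t%:E).
Proof.
move=> mA mA0 Aa.
have fT : m setT \is a fin_num by rewrite ge0_fin_numE.
rewrite -[a]/(fine a%:E) -fineM // fine_le //.
- by rewrite fin_numM.
- exact: integrable_fin_num.
rewrite (integral_concentrated mA mA0) -(measure_concentrated mA mA0).
rewrite -(integral_cst m mA a%:E); apply: le_integral => //.
- exact: integrable_cst_finite.
- exact: (integrableS measurableT).
by move=> t; rewrite inE => /Aa; rewrite lee_fin.
Qed.

End ConcentratedMeasure.

(** Kept abstract because two spaces are used: l^2(V, d) under the real part of its inner product,
    and the real functions on a finite set of permutations. *)
Record inner_form (R : realType) (H : lmodType R) (B : H -> H -> R) : Prop :=
  InnerForm {
    form_sym : forall x y, B x y = B y x;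
    form_linear : forall a x y z, B (a *: x + y) z = a * B x z + B y z;
    form_ge0 : forall x, 0 <= B x x;
    form_eq0 : forall x, B x x = 0 -> x = 0 }.

(** * Geometry of real inner product spaces *)

Section InnerForm.
Variables (R : realType) (H : lmodType R) (B : H -> H -> R).
Hypothesis hB : inner_form B.
Implicit Types x y z : H.

Lemma formDl x y z : B (x + y) z = B x z + B y z.
Proof. by rewrite -[x in LHS]scale1r (form_linear hB) mul1r. Qed.

Lemma form0l z : B 0 z = 0.
Proof.
by have := formDl 0 0 z; rewrite addr0 => h; apply: (@addrI _ (B 0 z)); rewrite addr0.
Qed.

Lemma formZl a x z : B (a *: x) z = a * B x z.
Proof. by rewrite -[a *: x]addr0 (form_linear hB) form0l addr0. Qed.

Lemma formNl x z : B (- x) z = - B x z.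
Proof. by rewrite -scaleN1r formZl mulN1r. Qed.

Lemma formDr x y z : B z (x + y) = B z x + B z y.
Proof. by rewrite !(form_sym hB z) formDl. Qed.

Lemma formZr a x z : B z (a *: x) = a * B z x.
Proof. by rewrite !(form_sym hB z) formZl. Qed.

Lemma formNr x z : B z (- x) = - B z x.
Proof. by rewrite !(form_sym hB z) formNl. Qed.

Definition formE := (formDl, formDr, formNl, formNr, formZl, formZr).

Lemma form_gt0 x : x <> 0 -> 0 < B x x.
Proof.
move=> x0; rewrite lt_neqAle (form_ge0 hB) andbT eq_sym.
by apply/eqP => /(form_eq0 hB).
Qed.

Lemma form_CauchySchwarz x y : B x y ^+ 2 <= B x x * B y y.
Proof.
have [->|/eqP/form_gt0 y0] := eqVneq y 0.
  by rewrite (form_sym hB) !form0l expr0n /= mulr0.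
(* The squared norm of this vector is [B y y] times the gap in the inequality. *)
have := form_ge0 hB (B y y *: x - B x y *: y).
rewrite !formE (form_sym hB y x) => h.
rewrite -subr_ge0 -(pmulr_rge0 _ y0); apply: le_trans h _.
by rewrite le_eqVlt; apply/orP; left; apply/eqP; ring.
Qed.

Definition norm_of x : R := Num.sqrt (B x x).

Lemma norm_of_ge0 x : 0 <= norm_of x. Proof. exact: sqrtr_ge0. Qed.

Lemma sqr_norm_of x : norm_of x ^+ 2 = B x x.
Proof. by rewrite sqr_sqrtr // (form_ge0 hB). Qed.

Lemma form_le_norm x y : B x y <= norm_of x * norm_of y.
Proof.
apply: le_trans (ler_norm _) _.
rewrite -(@ler_pXn2r _ 2) ?nnegrE ?mulr_ge0 ?norm_of_ge0 //.
by rewrite exprMn !sqr_norm_of real_normK ?num_real // form_CauchySchwarz.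
Qed.

Lemma norm_ofD x y : norm_of (x + y) <= norm_of x + norm_of y.
Proof.
rewrite -(@ler_pXn2r _ 2) ?nnegrE ?addr_ge0 ?norm_of_ge0 //.
rewrite sqrrD !sqr_norm_of !formE (form_sym hB y x).
by have h := form_le_norm x y; lra.
Qed.

Lemma norm_ofN x : norm_of (- x) = norm_of x.
Proof. by rewrite /norm_of !formE opprK. Qed.

Lemma norm_of_eq0 x : norm_of x <= 0 -> x = 0.
Proof.
move=> h; apply: (form_eq0 hB); rewrite -sqr_norm_of.
have -> : norm_of x = 0 by apply/eqP; rewrite eq_le h norm_of_ge0.
by rewrite expr0n.
Qed.

(* Acute angles add up at most: with a = <u,v> and b = <v,w>, the components of
   u and w orthogonal to v have squared norms 1 - a^2 and 1 - b^2. *)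
Lemma cos_triangle u v w (al be : R) :
  B u u = 1 -> B v v = 1 -> B w w = 1 ->
  0 <= al -> 0 <= be -> al + be <= pi ->
  cos al <= B u v -> cos be <= B v w -> cos (al + be) <= B u w.
Proof.
move=> uu vv ww al0 be0 abpi cu cw.
have B11 x y : B x x = 1 -> B y y = 1 -> -1 <= B x y <= 1.
  move=> xx yy; rewrite -ler_norml -(@ler_pXn2r _ 2) ?nnegrE //.
  by rewrite real_normK ?num_real // (le_trans (form_CauchySchwarz _ _)) // xx yy mulr1 expr1n.
have acos_le (r c : R) : -1 <= r <= 1 -> 0 <= c <= pi -> cos c <= r -> acos r <= c.
  move=> r1 c1; rewrite -{1}(acosK (x := r)) ?in_itv //=.
  by rewrite ler_cos // acos_ge0 // acos_lepi.
have uv1 := B11 _ _ uu vv; have vw1 := B11 _ _ vv ww.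
have aal : acos (B u v) <= al.
  by apply: acos_le => //; rewrite al0 /= (le_trans _ abpi) // lerDl.
have abe : acos (B v w) <= be.
  by apply: acos_le => //; rewrite be0 /= (le_trans _ abpi) // lerDr.
(* Cosine decreases on [0, pi], so [al] and [be] may be replaced by the true angles, whose sines and
   cosines are explicit. *)
apply: (@le_trans _ _ (cos (acos (B u v) + acos (B v w)))).
  have ab0 : 0 <= acos (B u v) + acos (B v w) by rewrite addr_ge0 ?acos_ge0.
  have ab_le := lerD aal abe.
  by rewrite ler_cos ?ab0 ?(le_trans ab_le) ?addr_ge0.
rewrite cosD !acosK ?in_itv //= !sin_acos //.
have := form_le_norm (- (u - B u v *: v)) (w - B v w *: v).
rewrite norm_ofN /norm_of !formE uu vv ww (form_sym hB v u) (form_sym hB w v).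
have -> : 1 - B u v * B u v + (- (B u v * B u v) - - (B u v * (B u v * 1))) = 1 - B u v ^+ 2 by ring.
have -> : 1 - B v w * B v w + (- (B v w * B v w) - - (B v w * (B v w * 1))) = 1 - B v w ^+ 2 by ring.
set s := Num.sqrt _; set s' := Num.sqrt _ => h; nra.
Qed.

End InnerForm.

(** * Resolutions of the identity *)

Section SpectralResolution.
Variables (R : realType) (H : lmodType R) (B : H -> H -> R).
Variables (E : set (measurableTypeR R) -> H -> H) (T : H -> H).
Implicit Types (A C : set (measurableTypeR R)) (x y z : H).

Definition spectral_scalar x (m : {measure set (measurableTypeR R) -> \bar R})
  : Prop := forall A, measurable A -> m A = (B (E A x) x)%:E.

(** A spectral measure together with its operator, on a real space. Additivity is carried by the
    scalar measures alone; [op_ge0] is proved for Q from its quadratic form. *)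
Record spectral_resolution : Prop := SpectralResolution {
  res_linear : forall A a x y, measurable A ->
    E A (a *: x + y) = a *: E A x + E A y;
  res_sym : forall A x y, measurable A -> B (E A x) y = B x (E A y);
  res_setI : forall A C x, measurable A -> measurable C ->
    E (A `&` C) x = E A (E C x);
  res_setT : forall x, E setT x = x;
  res_scalar : forall x, exists m, spectral_scalar x m;
  op_linear : forall a x y, T (a *: x + y) = a *: T x + T y;
  op_sym : forall x y, B (T x) y = B x (T y);
  op_ge0 : forall x, 0 <= B (T x) x;
  op_integral : forall x m, spectral_scalar x m ->
    m.-integrable [set: measurableTypeR R] (fun t => t%:E) /\
    B (T x) x = fine (\int[m]_(t in [set: measurableTypeR R]) t%:E) }.

Hypothesis hB : inner_form B.
Hypothesis hE : spectral_resolution.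

Let opD x y : T (x + y) = T x + T y.
Proof. by have := op_linear hE 1 x y; rewrite !scale1r. Qed.

Let op0 : T 0 = 0.
Proof.
by have := opD 0 0; rewrite addr0 => h; apply: (@addrI _ (T 0)); rewrite addr0.
Qed.

Let opZ a x : T (a *: x) = a *: T x.
Proof. by have := op_linear hE a x 0; rewrite op0 !addr0. Qed.

Let opN x : T (- x) = - T x. Proof. by rewrite -scaleN1r opZ scaleN1r. Qed.

Let resD A x y : measurable A -> E A (x + y) = E A x + E A y.
Proof. by move=> mA; have := res_linear hE 1 x y mA; rewrite !scale1r. Qed.

Let res0 A : measurable A -> E A 0 = 0.
Proof.
move=> mA; have := resD 0 0 mA; rewrite addr0 => h.
by apply: (@addrI _ (E A 0)); rewrite addr0.
Qed.

Let resN A x : measurable A -> E A (- x) = - E A x.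
Proof.
by move=> mA; have := res_linear hE (-1) x 0 mA; rewrite res0 // !addr0 !scaleN1r.
Qed.

Lemma res_idem A x : measurable A -> E A (E A x) = E A x.
Proof. by move=> mA; rewrite -(res_setI hE) // setIid. Qed.

Lemma form_res A x : measurable A -> B (E A x) x = B (E A x) (E A x).
Proof. by move=> mA; rewrite -{1}res_idem // (res_sym hE). Qed.

Lemma form_res_le A x : measurable A -> B (E A x) (E A x) <= B x x.
Proof.
move=> mA; have := form_ge0 hB (x - E A x).
rewrite !(formE hB) (form_sym hB x (E A x)) form_res // => h; lra.
Qed.

Lemma res_set0 x : E set0 x = 0.
Proof.
have [m mx] := res_scalar hE x; have := mx set0 measurable0.
rewrite measure0 form_res // => -[h].
by apply: (form_eq0 hB).
Qed.

Lemma res_disjoint A C x : measurable A -> measurable C -> A `&` C = set0 ->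
  E A (E C x) = 0.
Proof. by move=> mA mC AC0; rewrite -(res_setI hE) // AC0 res_set0. Qed.

(** The two projections have orthogonal ranges, so the squared norm of the difference is |x|^2 -
    |E(A) x|^2 - |E(~A) x|^2, which vanishes by additivity of the scalar measure. *)
Lemma res_setC A x : measurable A -> E A x + E (~` A) x = x.
Proof.
move=> mA; have mC := measurableC mA.
have [m mx] := res_scalar hE x.
have : (B x x)%:E = (m A + m (~` A))%E.
  have := mx _ measurableT; rewrite (res_setT hE) => <-.
  by rewrite -(measureU m mA mC (setICr A)) setUv.
rewrite (mx _ mA) (mx _ mC) -EFinD => -[h].
have cross : B (E A x) (E (~` A) x) = 0.
  by rewrite (res_sym hE) // res_disjoint ?setICr // (form_sym hB) (form0l hB).
apply/eqP; rewrite -subr_eq0; apply/eqP/(form_eq0 hB).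
rewrite !(formE hB) (form_sym hB (E (~` A) x) (E A x)) cross.
rewrite !(form_sym hB x (E _ x)) h !form_res //; ring.
Qed.

Lemma spectral_scalar_setT x m : spectral_scalar x m ->
  (m setT < +oo)%E /\ fine (m setT) = B x x.
Proof. by move=> /(_ _ measurableT); rewrite (res_setT hE) => ->; rewrite ltry. Qed.

Lemma spectral_scalar_concentrated A x m : measurable A -> E A x = x ->
  spectral_scalar x m -> m (~` A) = 0%E.
Proof.
move=> mA Ax mx; have mC := measurableC mA.
rewrite mx // -Ax res_disjoint //; last by rewrite setIC setICr.
by rewrite (form0l hB).
Qed.

(** For [x] in the range of E(A), the scalar measure is concentrated on [A], with mass |x|^2 and
    first moment <T x, x>. *)
Lemma op_le A (a : R) x : measurable A -> (forall t, A t -> t <= a) ->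
  E A x = x -> B (T x) x <= a * B x x.
Proof.
move=> mA Aa Ax; have [m mx] := res_scalar hE x.
have [m_fin <-] := spectral_scalar_setT mx; have [id_int ->] := op_integral hE mx.
exact: (integral_id_le m_fin id_int mA (spectral_scalar_concentrated mA Ax mx)).
Qed.

Lemma op_ge A (a : R) x : measurable A -> (forall t, A t -> a <= t) ->
  E A x = x -> a * B x x <= B (T x) x.
Proof.
move=> mA Aa Ax; have [m mx] := res_scalar hE x.
have [m_fin <-] := spectral_scalar_setT mx; have [id_int ->] := op_integral hE mx.
exact: (integral_id_ge m_fin id_int mA (spectral_scalar_concentrated mA Ax mx)).
Qed.

(* u + v and u - v have the same scalar measure when u and v lie in the ranges
   of E(A) and E(~A), hence <T(u + v), u + v> = <T(u - v), u - v>. *)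
Lemma op_orthogonal A x y : measurable A -> B (T (E A x)) (E (~` A) y) = 0.
Proof.
move=> mA; have mC := measurableC mA.
set u := E A x; set v := E (~` A) y.
have cross C : measurable C -> B (E C u) v = 0.
  move=> mCC; rewrite /v -(res_sym hE) // /u -!(res_setI hE) //; last first.
    exact: measurableI.
  rewrite setIC setIA setICr set0I res_set0.
  exact: (form0l hB).
have cross' C : measurable C -> B (E C v) u = 0.
  by move=> mCC; rewrite (res_sym hE) // (form_sym hB) cross.
have [m mx] := res_scalar hE (u + v).
have mx' : spectral_scalar (u - v) m.
  move=> C mCC; rewrite mx // !resD // resN //; congr EFin.
  by rewrite !(formE hB) cross // cross' //; ring.
have [_] := op_integral hE mx; have [_ <-] := op_integral hE mx'.
rewrite !opD opN !(formE hB) (op_sym hE v u) (form_sym hB v (T u)).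
by move=> h; lra.
Qed.

(** By [op_orthogonal], [T] leaves the ranges of E(A) and E(~A) stable; splitting [x] along both
    gives the commutation. *)
Lemma op_res_comm A x : measurable A -> T (E A x) = E A (T x).
Proof.
move=> mA; have mC := measurableC mA.
have kill C y : measurable C -> E (~` C) (T (E C y)) = 0.
  move=> mCC; apply: (form_eq0 hB); rewrite (res_sym hE); last exact: measurableC.
  exact: op_orthogonal.
rewrite -[in RHS](res_setC x mA) opD resD //.
have := kill _ x mC; rewrite setCK => ->; rewrite addr0.
by rewrite -[LHS](res_setC _ mA) kill // addr0.
Qed.

(** To pass from forms to norms, positivity of [T] at a x - T x and the form bound at T x are
    combined into |T x|^2 <= a <T x, x>. *)
Lemma norm_op_le A (a : R) x : measurable A -> 0 < a ->
  (forall t, A t -> t <= a) -> E A x = x ->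
  norm_of B (T x) <= a * norm_of B x.
Proof.
move=> mA a0 Aa Ax.
have ATx : E A (T x) = T x by rewrite -op_res_comm // Ax.
rewrite -(@ler_pXn2r _ 2) ?nnegrE ?mulr_ge0 ?norm_of_ge0 ?(ltW a0) //.
rewrite exprMn !(sqr_norm_of hB).
have h1 := op_le mA Aa Ax.
have h2 := op_le mA Aa ATx.
(* a T (a - T) = T (a - T) T + (a - T) T (a - T) *)
have h3 := op_ge0 hE (a *: x - T x).
move: h3; rewrite opD opN opZ !(formE hB).
rewrite (op_sym hE (T x) x) (form_sym hB (T x) x) in h1 h2 *.
move=> h3.
have h4 : B (T x) (T x) <= a * B (T x) x.
  rewrite -subr_ge0 -(pmulr_rge0 _ a0).
  rewrite (form_sym hB (T x) x); nra.
rewrite expr2 -mulrA; apply: le_trans h4 _.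
by rewrite (ler_pM2l a0) (form_sym hB).
Qed.

(** Cauchy-Schwarz: b |x|^2 <= <T x, x> <= |T x| |x|. *)
Lemma norm_op_ge A (b : R) x : measurable A ->
  (forall t, A t -> b <= t) -> E A x = x ->
  b * norm_of B x <= norm_of B (T x).
Proof.
move=> mA Ab Ax; have := le_trans (op_ge mA Ab Ax) (form_le_norm hB _ _).
rewrite -(sqr_norm_of hB) expr2 mulrA.
have := norm_of_ge0 B x; rewrite le_eqVlt => /predU1P[<-|x0].
  by rewrite !mulr0 norm_of_ge0.
by rewrite (ler_pM2r x0).
Qed.

(** The squared norm of a projection of [x] is a value of its scalar measure, for which countable
    unions of null sets are null. *)
Lemma res_itv_bigcup (F : nat -> set (measurableTypeR R)) x :
  (forall n, measurable (F n)) -> (forall n, E (F n) x = 0) ->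
  E (\bigcup_n F n) x = 0.
Proof.
move=> mF F0; have [m mx] := res_scalar hE x.
have mU : measurable (\bigcup_n F n) by exact: bigcup_measurable.
apply: (form_eq0 hB); rewrite -form_res //.
apply: EFin_inj; rewrite -mx //; apply: measure_negligible => //.
apply: negligible_bigcup => n; exists (F n); split => //.
by rewrite mx // F0 (form0l hB).
Qed.

(** On the range of E(]-oo, -b]) with b > 0, the form of [T] is at most -b |y|^2 and yet
    nonnegative, so this range is zero; b runs through the numbers 1/(n+1). *)
Lemma res_neg x : E [set` `]-oo, 0[ ] x = 0.
Proof.
have -> : [set` `]-oo, (0 : R)[ ] = \bigcup_n [set` `]-oo, - n.+1%:R^-1] ] :> set R.
  apply/seteqP; split => t /=; rewrite !in_itv /=.
    move=> t0; exists (Num.truncn (- t)^-1) => //=.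
    rewrite in_itv /= lerNr invf_ple ?posrE ?oppr_gt0 //.
    by apply/ltW/truncnS_gt.
  by move=> [n _] /=; rewrite in_itv /= => /le_lt_trans; apply; rewrite oppr_lt0.
apply: res_itv_bigcup => n; first exact: measurable_itv.
set A := [set` _]; set b : R := n.+1%:R^-1.
have mA : measurable (A : set (measurableTypeR R)) by exact: measurable_itv.
have b0 : 0 < b by rewrite invr_gt0.
have Ab t : A t -> t <= - b by rewrite /A /= in_itv.
have := le_trans (op_ge0 hE _) (op_le mA Ab (res_idem x mA)).
rewrite mulNr oppr_ge0 (pmulr_rle0 _ b0) => h.
by apply: (form_eq0 hB); apply/eqP; rewrite eq_le h (form_ge0 hB).
Qed.

(** * Spectral projections and isometries commuting with the operator *)

Variable U : H -> H.
Hypothesis U_isometry : forall x y, B (U x) (U y) = B x y.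
Hypothesis U_op : forall x, U (T x) = T (U x).

Let norm_U x : norm_of B (U x) = norm_of B x.
Proof. by rewrite /norm_of U_isometry. Qed.

(* T shrinks the range of E([0,a]) by a and expands that of E(]b,oo[) by b > a,
   so the intertwiner E(]b,oo[) U E([0,a]) vanishes. *)
Lemma res_gap (a b : R) x : 0 < a -> a < b ->
  E [set` `[0, a]] x = x -> E [set` `]b, +oo[ ] (U x) = 0.
Proof.
move=> a0 ab.
set A := [set` `[0, a]]; set C := [set` `]b, +oo[ ].
have mA : measurable (A : set (measurableTypeR R)) by exact: measurable_itv.
have mC : measurable (C : set (measurableTypeR R)) by exact: measurable_itv.
have Aa t : A t -> t <= a by rewrite /A /= in_itv => /andP[].
have Cb t : C t -> b <= t by rewrite /C /= in_itv andbT => /ltW.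
have b0 := lt_trans a0 ab.
have power n : forall y, E A y = y ->
    b ^+ n * norm_of B (E C (U y)) <= a ^+ n * norm_of B y.
  elim: n => [|n IH] y Ay.
    rewrite !expr0 !mul1r -(norm_U y).
    rewrite -(@ler_pXn2r _ 2) ?nnegrE ?norm_of_ge0 // !(sqr_norm_of hB).
    exact: form_res_le.
  have ATy : E A (T y) = T y by rewrite -op_res_comm // Ay.
  rewrite !exprSr -!mulrA.
  apply: (@le_trans _ _ (b ^+ n * norm_of B (T (E C (U y))))).
    by rewrite ler_pM2l ?exprn_gt0 //; apply: (norm_op_ge mC Cb); rewrite res_idem.
  rewrite op_res_comm // -U_op; apply: le_trans (IH _ ATy) _.
  by rewrite ler_pM2l ?exprn_gt0 //; apply: (norm_op_le mA a0 Aa).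
move=> Ax; apply: (norm_of_eq0 hB).
(* The power bound reads |E(C) U x| <= |x| (a/b)^n for every n, and the right side tends to 0
   because a < b. *)
have lim0 : (fun n => norm_of B x * (a / b) ^+ n) @ \oo --> norm_of B x * 0.
  apply: cvgMr; apply: cvg_expr.
  by rewrite ger0_norm ?divr_ge0 ?ltW // ltr_pdivrMr // mul1r.
rewrite mulr0 in lim0; apply: (cvgr_to_ge lim0).
apply: nearW => n; rewrite expr_div_n mulrA ler_pdivlMr ?exprn_gt0 //.
by rewrite mulrC (mulrC (norm_of B x)) power.
Qed.

(** [res_gap] asks for a gap above [a], so ]a, +oo[ is exhausted by the half-lines ]a + 1/(k+1),
    +oo[; the negative half-line is handled by [res_neg]. *)
Lemma res_itv_stable (a : R) x : 0 < a ->
  E [set` `[0, a]] x = x -> E [set` `[0, a]] (U x) = U x.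
Proof.
move=> a0 Ax; set A := [set` `[0, a]].
have mA : measurable (A : set (measurableTypeR R)) by exact: measurable_itv.
rewrite -[RHS](res_setC (U x) mA).
suff -> : E (~` A) (U x) = 0 by rewrite addr0.
have -> : ~` A = \bigcup_n (if n is k.+1 then [set` `]a + k.+1%:R^-1, +oo[ ]
    else [set` `]-oo, 0[ ]) :> set R.
  apply/seteqP; split => t /=; rewrite ?in_itv /=.
    move/negP; rewrite negb_and -!ltNge => /orP[t0|ta].
      by exists 0%N => //=; rewrite in_itv.
    exists (Num.truncn (t - a)^-1).+1 => //=.
    rewrite in_itv /= andbT -ltrBrDl invf_plt ?posrE ?subr_gt0 //.
    exact: truncnS_gt.
  case=> -[|k] _ /=; rewrite in_itv /= ?andbT => h /andP[t0 ta].
    by have := lt_le_trans h t0; rewrite ltxx.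
  by have := lt_le_trans h ta; rewrite gtrDl invr_lt0 ltrn0.
apply: res_itv_bigcup => -[|k].
- exact: measurable_itv.
- exact: measurable_itv.
- exact: res_neg.
by apply: (res_gap a0 _ Ax); rewrite ltrDl.
Qed.

(** With P = E([0,a]), the vector U P x lies in the range of P, so <P U x, U P x> = <U x, U P x> =
    |P x|^2, and Cauchy-Schwarz concludes. *)
Lemma res_itv_isometry_le (a : R) x : 0 < a ->
  B (E [set` `[0, a]] x) x <= B (E [set` `[0, a]] (U x)) (U x).
Proof.
move=> a0; set A := [set` `[0, a]].
have mA : measurable (A : set (measurableTypeR R)) by exact: measurable_itv.
have stable := res_itv_stable a0 (res_idem x mA).
have Uv : B (E A (U x)) (U (E A x)) = B (E A x) x.
  by rewrite (res_sym hE) // stable U_isometry (form_sym hB).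
have := form_CauchySchwarz hB (E A (U x)) (U (E A x)).
rewrite Uv U_isometry -!form_res //.
have := form_ge0 hB (E A x); rewrite -form_res // le_eqVlt => /predU1P[<- _|x0].
  by rewrite form_res // (form_ge0 hB).
by rewrite expr2 (ler_pM2r x0).
Qed.

End SpectralResolution.

(** * Walks and spectral embeddings *)

Section RegularGraph.
Variables (V : choiceType) (e : rel V) (d : nat).
Hypothesis simple_e : simple_graph e.
Hypothesis connected_e : connected_graph e.
Hypothesis degree_e : regular_graph e d.
Implicit Types x y z : V.

(** A duplicate-free list, so that sums over neighbours are ordinary finite sums even on an infinite
    graph; by [finite_nbrs], [fset_set] does not take its default value. *)
Definition nbrs x : seq V := enum_fset (fset_set [set y | e x y]).

Lemma finite_nbrs x : finite_set [set y | e x y].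
Proof. by exists d; exact: degree_e. Qed.

Lemma mem_nbrs x y : (y \in nbrs x) = e x y.
Proof. by rewrite (in_fset_set (finite_nbrs x)); apply/idP/idP; rewrite inE. Qed.

Lemma uniq_nbrs x : uniq (nbrs x).
Proof. exact: fset_uniq. Qed.

Lemma size_nbrs x : size (nbrs x) = d.
Proof. by rewrite -(card_fset_set (degree_e x)). Qed.

Lemma big_nbrs (M : nmodType) x (F : V -> M) :
  \sum_(y \in [set y | e x y]) F y = \sum_(y <- nbrs x) F y.
Proof. by rewrite fsbig_finite //; exact: finite_nbrs. Qed.

Lemma big_nbrs_automorphism (M : nmodType) (phi : V -> V) x (F : V -> M) :
  graph_automorphism e phi ->
  \sum_(y <- nbrs (phi x)) F y = \sum_(y <- nbrs x) F (phi y).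
Proof.
move=> [[psi phiK psiK] phi_e]; rewrite -(big_map phi xpredT F).
apply: perm_big; apply: uniq_perm; rewrite ?uniq_nbrs //.
  by rewrite map_inj_uniq ?uniq_nbrs //; exact: can_inj phiK.
move=> y; rewrite -(psiK y) (mem_map (can_inj phiK)) !mem_nbrs.
exact: phi_e.
Qed.

Lemma walk0 x y : walk e 0 x y <-> x = y.
Proof.
split=> [[p [_ <- /size0nil ->]] //|->]; by exists [::].
Qed.

Lemma walkS n x y : walk e n.+1 x y <-> exists2 z, walk e n x z & e z y.
Proof.
split=> [[p []]|[z [p [pe lp sp]] zy]].
  case/lastP: p => [//|p z]; rewrite rcons_path last_rcons size_rcons.
  by move=> /andP[pe ez] <- [sp]; exists (last x p) => //; exists p.
by exists (rcons p y); rewrite rcons_path last_rcons size_rcons pe lp sp.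
Qed.

Lemma walk_sym n x y : walk e n x y -> walk e n y x.
Proof.
move=> [p [pe lp sp]]; exists (rev (belast x p)).
rewrite -lp rev_path size_rev size_belast; split=> //.
  by rewrite (@eq_path _ _ e) // => a b; rewrite simple_e.1.
by case: p {pe lp sp} => //= a p; rewrite rev_cons last_rcons.
Qed.

Lemma walk_cat n m x y z : walk e n x y -> walk e m y z -> walk e (n + m) x z.
Proof.
move=> [p [pe lp sp]] [p' [pe' lp' sp']]; exists (p ++ p').
by rewrite cat_path last_cat size_cat pe lp pe' lp' sp sp'.
Qed.

Lemma walk_dist x y : walk e (dist e x y) x y.
Proof.
rewrite /dist; case: pselect => [h|[]].
  by case: ex_minnP => n /asboolP.
by have [n xy] := connected_e x y; exists n; apply/asboolP.
Qed.

Lemma distxx x : dist e x x = 0%N.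
Proof.
rewrite /dist; case: pselect => // h; case: ex_minnP => n _ /(_ 0%N) n0.
by apply/eqP; rewrite -leqn0 n0 //; apply/asboolP/walk0.
Qed.

Lemma finite_walk n x : finite_set [set y | walk e n x y].
Proof.
elim: n => [|n IH].
  rewrite (_ : [set y | _] = [set x]); first exact: finite_set1.
  by apply/seteqP; split=> y /=; rewrite walk0.
rewrite (_ : [set y | _] = \bigcup_(z in [set z | walk e n x z]) [set y | e z y]).
  by apply: bigcup_finite => // z _; exact: finite_nbrs.
by apply/seteqP; split=> y /=; rewrite walkS => -[z]; exists z.
Qed.

(** The ball is covered by the endpoints of walks from [x] of length at most the integer part of
    [r], a finite union of finite sets. *)
Lemma finite_ball (R : realType) x (r : R) :
  finite_set [set v | (dist e v x)%:R <= r].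
Proof.
apply: (@sub_finite_set _ _
  (\bigcup_(n in `I_(Num.truncn r).+1) [set y | walk e n x y])).
  move=> y /= yr; exists (dist e y x); last exact/walk_sym/walk_dist.
  by rewrite /= -(ltr_nat R); apply: le_lt_trans yr (truncnS_gt _).
apply: bigcup_finite => [|n _]; first exact: finite_II.
exact: finite_walk.
Qed.

(* Otherwise the parity of the distance to x would be a bipartition. *)
Lemma odd_closed_walk : ~ bipartite_graph e ->
  exists x y z, walk e (dist e x y + dist e x z).+1 x x /\
                odd (dist e x y + dist e x z).+1.
Proof.
move=> nonbip.
have [[x]|noV] := pselect (exists x : V, True); last first.
  by case: nonbip; exists (fun=> true) => x; case: noV; exists x.
apply: contrapT => none; apply: nonbip.
exists (fun v => odd (dist e x v)) => y z yz; apply/negP => /eqP yzodd.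
apply: none; exists x, y, z; split; last by rewrite /= oddD yzodd addbb.
(* The closed walk goes from [x] to [y], along the edge to [z], and back to [x]. *)
rewrite -addnS; apply: walk_cat (walk_dist x y) _.
rewrite -add1n; apply: (@walk_cat _ _ y z x).
  by apply/walkS; exists y => //; apply/walk0.
exact/walk_sym/walk_dist.
Qed.

Lemma dist_le_diam (R : realType) x y : finite_set [set: V] ->
  (dist e x y)%:R <= diam e R.
Proof.
move=> finV; apply: ub_le_sup; last by exists (x, y).
have finVV : finite_set [set: V * V] by rewrite -setXTT; exact: finite_setX.
(* The sum of all distances is an upper bound, so the supremum is not a default value. *)
exists (\sum_(p \in [set: V * V]) ((dist e p.1 p.2)%:R : R)) => _ [p _ <-].
rewrite fsbig_finite //= (big_fsetD1 p) /=; last by rewrite in_fset_set // inE.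
by rewrite lerDl sumr_ge0.
Qed.

(** In degree 0 there are no edges, and a constant colouring is vacuously a bipartition. *)
Lemma degree_gt0 : ~ bipartite_graph e -> (0 < d)%N.
Proof.
move=> nonbip; rewrite lt0n; apply/negP => /eqP d0; apply: nonbip.
exists (fun=> true) => x y; rewrite -mem_nbrs.
by have := size_nbrs x; rewrite d0 => /size0nil ->.
Qed.

End RegularGraph.

(** * Vertex embeddings of small signless energy *)

Section SpectralEmbedding.
Variables (R : realType) (H : lmodType R) (B : H -> H -> R).
Hypothesis hB : inner_form B.
Variables (V : choiceType) (e : rel V) (d : nat) (F : V -> H) (mu lam : R).
Hypothesis degree_e : regular_graph e d.
Hypothesis F_norm : forall x, B (F x) (F x) = mu.
(** One inequality for two uses: [lam] is delta for the projected vertex vectors, and the eigenvalue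
    for the averaged eigenfunction. *)
Hypothesis F_energy : forall x,
  d%:R * mu + \sum_(y <- nbrs e x) B (F x) (F y) <= d%:R * (lam * mu).

Let mu_ge0 (x : V) : 0 <= mu.
Proof. by rewrite -(F_norm x) (form_ge0 hB). Qed.

(** The sum of |F x + F z|^2 over the neighbours z of [x] is twice the left side of [F_energy], and
    a single term is at most the sum. *)
Lemma embedding_edge x y : e x y ->
  B (F x + F y) (F x + F y) <= 2 * (d%:R * (lam * mu)).
Proof.
move=> xy.
apply: (@le_trans _ _ (\sum_(z <- nbrs e x) B (F x + F z) (F x + F z))).
  rewrite (big_rem y) /=; last by rewrite (mem_nbrs degree_e).
  by rewrite lerDl; apply: sumr_ge0 => z _; exact: form_ge0 hB _.
have -> : \sum_(z <- nbrs e x) B (F x + F z) (F x + F z) =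
    2 * (d%:R * mu + \sum_(z <- nbrs e x) B (F x) (F z)).
  have sq z : B (F x + F z) (F x + F z) = 2 * mu + 2 * B (F x) (F z).
    by rewrite !(formE hB) (form_sym hB (F z) (F x)) !F_norm; ring.
  under eq_bigr do rewrite sq.
  rewrite big_split /= -!mulr_sumr big_const_seq count_predT (size_nbrs degree_e).
  by rewrite iter_addr_0 -(mulr_natl mu); ring.
by rewrite ler_pM2l.
Qed.

(** Each edge reverses the sign of F up to the error of [embedding_edge]; the errors add by the
    triangle inequality. *)
Lemma embedding_walk k x y : walk e k x y ->
  norm_of B (F y - (-1) ^+ k *: F x) <=
    k%:R * Num.sqrt (2 * (d%:R * (lam * mu))).
Proof.
elim: k y => [|k IH] y.
  move=> /walk0 ->; rewrite expr0 scale1r subrr mul0r.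
  by rewrite /norm_of (form0l hB) sqrtr0.
move=> /walkS[z /IH xz zy].
rewrite (_ : _ - _ = (F z + F y) + - (F z - (-1) ^+ k *: F x)); last first.
  by rewrite exprS mulN1r scaleNr opprD !opprK addrACA subrr add0r.
apply: le_trans (norm_ofD hB _ _) _; rewrite (norm_ofN hB).
rewrite -natr1 mulrDl mul1r addrC lerD //.
by rewrite /norm_of ler_wsqrtr // embedding_edge.
Qed.

(** Squaring [embedding_walk] gives 2 mu - 2 (-1)^k <F x, F y> <= 2 k^2 d lam mu; the absolute value
    removes the parity of k. *)
Lemma embedding_correlation k x y : 0 <= lam -> walk e k x y ->
  mu * (1 - k%:R ^+ 2 * (d%:R * lam)) <= `|B (F x) (F y)|.
Proof.
move=> lam0 xy; have := embedding_walk xy.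
have lmu0 : 0 <= 2 * (d%:R * (lam * mu)) by rewrite !mulr_ge0 // (mu_ge0 x).
rewrite -(@ler_pXn2r _ 2) ?nnegrE ?mulr_ge0 ?norm_of_ge0 ?sqrtr_ge0 //.
rewrite exprMn (sqr_sqrtr lmu0) (sqr_norm_of hB).
have s2 : (-1) ^+ k * (-1) ^+ k = 1 :> R by rewrite -expr2 sqrr_sign.
have -> : B (F y - (-1) ^+ k *: F x) (F y - (-1) ^+ k *: F x) =
    mu + (-1) ^+ k * (-1) ^+ k * mu - 2 * ((-1) ^+ k * B (F x) (F y)).
  by rewrite !(formE hB) !F_norm (form_sym hB (F y) (F x)); ring.
rewrite s2 => h.
have : (-1) ^+ k * B (F x) (F y) <= `|B (F x) (F y)|.
  by rewrite (le_trans (ler_norm _)) // normrM normrX normrN1 expr1n mul1r.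
by move=> h'; nra.
Qed.

(** The unit vectors (-1)^j F along the walk turn by at most theta per edge, since 2 + 2 <F z, F y>
    <= 2 d lam <= 2 - 2 cos theta; [cos_triangle] adds the angles. *)
Lemma embedding_cos (theta : R) k x y : mu = 1 ->
  0 <= theta -> k%:R * theta <= pi -> d%:R * lam <= 1 - cos theta ->
  walk e k x y -> cos (k%:R * theta) <= (-1) ^+ k * B (F x) (F y).
Proof.
move=> mu1 th0 kth dlam; elim: k y kth => [|k IH] y kth.
  by move=> /walk0 <-; rewrite mul0r cos0 expr0 mul1r F_norm mu1.
move=> /walkS[z xz zy].
have kth' : k%:R * theta <= pi.
  by apply: le_trans kth; rewrite ler_wpM2r // ler_nat.
have s2 j : (-1) ^+ j * (-1) ^+ j = 1 :> R by rewrite -expr2 sqrr_sign.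
have := @cos_triangle _ _ _ hB (F x) ((-1) ^+ k *: F z) ((-1) ^+ k.+1 *: F y)
  (k%:R * theta) theta.
have kS : k%:R * theta + theta = k.+1%:R * theta by rewrite -natr1 mulrDl mul1r.
rewrite !(formE hB) kS => tri; apply: tri; rewrite ?F_norm ?mu1 ?mulr_ge0 //.
- by rewrite mulr1 s2.
- by rewrite mulr1 s2.
- exact: IH.
have := embedding_edge zy.
rewrite !(formE hB) !F_norm (form_sym hB (F y) (F z)) mu1 => h.
by rewrite exprS mulN1r mulNr mulrN mulrA s2 mul1r; lra.
Qed.

End SpectralEmbedding.

(** * Eigenvalues on finite graphs *)

Lemma ffun_inner_form (R : realType) (I : finType) :
  @inner_form R {ffun I -> R} (fun u v => \sum_i u i * v i).
Proof.
split=> [u v|a u v w|u|u u0].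
- by apply: eq_bigr => i _; rewrite mulrC.
- rewrite mulr_sumr -big_split /=; apply: eq_bigr => i _.
  by rewrite !ffunE mulrDl mulrA.
- by apply: sumr_ge0 => i _; rewrite -expr2 sqr_ge0.
apply/ffunP => i; rewrite ffunE; apply/eqP; rewrite -sqrf_eq0 expr2.
by apply/eqP/(psumr_eq0P _ u0) => // j _; rewrite -expr2 sqr_ge0.
Qed.

Section FiniteEigenvalue.
Variables (R : realType) (V : choiceType) (e : rel V) (d : nat).
Hypothesis transitive_e : vertex_transitive e.
Hypothesis degree_e : regular_graph e d.
Hypothesis d_gt0 : (0 < d)%N.
Hypothesis finV : finite_set [set: V].
Variables (g : V -> R) (lam : R).
Hypothesis g_eigen : forall x, g x + d%:R^-1 * \sum_(y <- nbrs e x) g y = lam * g x.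
Variable z0 : V.
Hypothesis g_neq0 : g z0 != 0.

Local Notation W := (fset_set [set: V]).

Let in_W x : x \in W. Proof. by rewrite in_fset_set // inE. Qed.

Let toW x : W := FSetSub (in_W x).

Let toWK w : toW (val w) = w. Proof. exact: val_inj. Qed.

(** As permutations of a finite type, automorphisms can be summed over, and the sums reindexed by
    group multiplication. *)
Let aut (p : {perm W}) : bool :=
  [forall u, forall v, e (val (p u)) (val (p v)) == e (val u) (val v)].

Let pact (p : {perm W}) x : V := val (p (toW x)).

Let pact_automorphism p : aut p -> graph_automorphism e (pact p).
Proof.
move=> /forallP autp; split; last first.
  by move=> x y; have /forallP/(_ (toW y))/eqP := autp (toW x).
exists (fun x => val (p^-1%g (toW x))) => x; rewrite /pact toWK.
  by rewrite permK.
by rewrite permKV.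
Qed.

(* Averaging over the automorphism group makes the norm of F constant. *)
Let B (u v : {ffun {perm W} -> R}) := \sum_i u i * v i.
Let F x : {ffun {perm W} -> R} := [ffun p => if aut p then g (pact p x) else 0].
Let hB : inner_form B := @ffun_inner_form R {perm W}.

Let BF x y : B (F x) (F y) = \sum_(p | aut p) g (pact p x) * g (pact p y).
Proof.
rewrite /B [RHS]big_mkcond /=; apply: eq_bigr => p _; rewrite !ffunE.
by case: ifP => // _; rewrite mul0r.
Qed.

(** Translating the permutations by an automorphism that takes [x] to [y] turns one sum into the
    other; it is the left factor because products of permutations apply the left factor first. *)
Let F_norm x y : B (F x) (F x) = B (F y) (F y).
Proof.
have [phi [[psi phiK psiK] phi_e] <-] := transitive_e x y.
have inj_phi : injective (fun w : W => toW (phi (val w))).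
  move=> u v uv; apply: val_inj; apply: (can_inj phiK).
  exact: (congr1 val uv).
rewrite !BF (reindex_inj (mulgI (perm inj_phi))) /=.
have actM p z : pact (perm inj_phi * p)%g z = pact p (phi z).
  by rewrite /pact permM permE.
apply: eq_big => [p|p _]; last by rewrite actM.
have val_phi w : val (perm inj_phi w) = phi (val w) by rewrite permE.
apply/forallP/forallP => autp u; apply/forallP => v.
  have /forallP/(_ (toW (psi (val v)))) := autp (toW (psi (val u))).
  by rewrite !permM !permE /= !psiK !toWK => /eqP ->; rewrite -phi_e !psiK.
have /forallP/(_ (perm inj_phi v))/eqP := autp (perm inj_phi u).
by rewrite !permM => ->; rewrite !val_phi phi_e.
Qed.

(** Each automorphism p contributes the eigenvalue equation at p x times d g(p x); the neighbours of
    p x are the images of those of [x]. *)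
Let F_energy x : d%:R * B (F x) (F x) + \sum_(y <- nbrs e x) B (F x) (F y) =
  d%:R * (lam * B (F x) (F x)).
Proof.
under eq_bigr do rewrite BF.
rewrite exchange_big /= !BF !mulr_sumr -big_split /=; apply: eq_bigr => p autp.
rewrite -mulr_sumr -(big_nbrs_automorphism degree_e _ _ (pact_automorphism autp)).
have d0 : (d%:R : R) != 0 by rewrite pnatr_eq0 -lt0n.
have := g_eigen (pact p x); move=> /(congr1 (fun r => d%:R * r)).
rewrite mulrDr mulVKf // => h.
transitivity (g (pact p x) * (d%:R * (lam * g (pact p x)))); last by ring.
by rewrite -h; ring.
Qed.

(** Otherwise [embedding_cos] along the odd closed walk, for the normalized embedding, gives cos(k
    theta) <= -1, impossible when 0 <= k theta < pi. *)
Lemma eigenvalue_gt (theta : R) k x : walk e k x x -> odd k ->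
  0 <= theta -> k%:R * theta < pi -> 1 - cos theta < d%:R * lam.
Proof.
move=> kx odd_k th0 kth; rewrite ltNge; apply/negP => dlam.
have mu0 : 0 < B (F x) (F x).
  (* The coordinate of [F z0] at the identity permutation is [g z0], which is nonzero. *)
  rewrite (F_norm x z0); apply: (form_gt0 hB) => /ffunP /(_ 1%g).
  rewrite !ffunE /pact perm1 /= ifT => [/eqP|]; first exact/negP.
  by apply/forallP => u; apply/forallP => v; rewrite !perm1.
pose s := (Num.sqrt (B (F x) (F x)))^-1.
have s2 : s * (s * B (F x) (F x)) = 1.
  by rewrite mulrA -expr2 exprVn sqr_sqrtr ?ltW // mulVf // gt_eqF.
have sF_norm y : B (s *: F y) (s *: F y) = 1.
  by rewrite !(formE hB) (F_norm y x).
have sF_energy y : d%:R * 1 + \sum_(z <- nbrs e y) B (s *: F y) (s *: F z)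
    <= d%:R * (lam * 1).
  under eq_bigr do rewrite !(formE hB).
  have sy : s * (s * B (F y) (F y)) = 1 by rewrite (F_norm y x).
  have := congr1 (fun r => s * (s * r)) (F_energy y) => /= h.
  rewrite -!mulr_sumr le_eqVlt; apply/orP; left; apply/eqP.
  set S := \sum_(_ <- _) _ in h *.
  transitivity (d%:R * (s * (s * B (F y) (F y))) + s * (s * S)).
    by rewrite sy.
  transitivity (s * (s * (d%:R * (lam * B (F y) (F y))))).
    by rewrite -h; ring.
  by rewrite -sy; ring.
have := embedding_cos hB degree_e sF_norm sF_energy erefl th0 (ltW kth) dlam kx.
rewrite sF_norm -signr_odd odd_k expr1 mulr1 -cospi ler_cos ?pi_ge0 ?lexx //.
  by rewrite leNgt kth.
by rewrite mulr_ge0 // ltW.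
Qed.

End FiniteEigenvalue.

(** * Unordered sums and l^2(V, d) *)

Section RealSums.
Variables (R : realType) (V : choiceType).
Implicit Types (f g h : V -> R).

Local Notation esumT f := (\esum_(x in [set: V]) (f x)%:E)%E.

Definition rsummable f : bool := summable [set: V] (EFin \o f).

Lemma rsummable_esum f : (forall x, 0 <= f x) -> rsummable f = (esumT f < +oo)%E.
Proof.
move=> f0; rewrite /rsummable /summable; congr (_ < _)%E.
by apply: eq_esum => x _ /=; rewrite ger0_norm.
Qed.

Lemma le_rsummable f g : (forall x, `|f x| <= g x) -> rsummable g -> rsummable f.
Proof.
move=> fg; have g0 x : 0 <= g x by apply: le_trans (fg x).
rewrite rsummable_esum //; apply: le_lt_trans; apply: le_esum => x _ /=.
by rewrite lee_fin.
Qed.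

(** One inequality is checked on finite subsets; for nonzero [a] the other is the same inequality
    for the inverse of [a]. *)
Lemma esumZ (a : R) f : 0 <= a -> (forall x, 0 <= f x) ->
  esumT (fun x => a * f x) = (a%:E * esumT f)%E.
Proof.
have half (c : R) k : 0 <= c -> (forall x, 0 <= k x) ->
    (esumT (fun x => c * k x)%R <= c%:E * esumT k)%E.
  move=> c0 k0; apply: ge_ereal_sup => _ [X [finX _] <-].
  rewrite fsbig_finite //=; under eq_bigr do rewrite EFinM.
  rewrite -ge0_sume_distrr => [|x _]; last by rewrite lee_fin.
  apply: lee_wpmul2l; first by rewrite lee_fin.
  apply: esum_ge; exists X => //; by rewrite fsbig_finite.
move=> a0 f0; apply/eqP; rewrite eq_le half //=.
have [->|a_neq0] := eqVneq a 0.
  by rewrite mul0e esum_ge0 // => x _; rewrite lee_fin mul0r.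
have ai0 : 0 <= a^-1 by rewrite invr_ge0.
have := half a^-1 (fun x => a * f x) ai0 (fun x => mulr_ge0 a0 (f0 x)).
under eq_esum do rewrite mulKf //.
move=> /(lee_wpmul2l (x := a%:E)); rewrite lee_fin a0 => /(_ isT).
by rewrite muleA -EFinM divff // mul1e.
Qed.

Lemma rsummableD f g : rsummable f -> rsummable g ->
  rsummable (fun x => f x + g x).
Proof. exact: summableD. Qed.

Lemma rsummableZ (a : R) f : rsummable f -> rsummable (fun x => a * f x).
Proof.
move=> sf; apply: (@le_rsummable _ (fun x => `|a| * `|f x|)).
  by move=> x; rewrite normrM.
rewrite rsummable_esum => [|x]; last by rewrite mulr_ge0.
by rewrite esumZ // lte_mul_pinfty // lee_fin.
Qed.

Lemma rsummableB f g : rsummable f -> rsummable g ->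
  rsummable (fun x => f x - g x).
Proof. exact: summableB. Qed.

Lemma rsum_ge0E f : (forall x, 0 <= f x) -> rsum f = fine (esumT f).
Proof.
move=> f0; rewrite /rsum (eq_esum (b := EFin \o f)); last first.
  by move=> x _; rewrite (ge0_funeposE (D := setT)) ?inE // => y _; rewrite lee_fin.
rewrite [X in (_ - X)%E]esum1 ?sube0 // => x _.
by rewrite (ge0_funenegE (D := setT)) ?inE // => y _; rewrite lee_fin.
Qed.

Lemma rsum_ge0 f : (forall x, 0 <= f x) -> 0 <= rsum f.
Proof.
by move=> f0; rewrite rsum_ge0E // fine_ge0 // esum_ge0 // => x _; rewrite lee_fin.
Qed.

(** [rsum] is defined through the positive and negative parts of its summand, but any difference of
    nonnegative summable functions may be used; linearity rests on this. *)
Lemma rsum_subE f g : (forall x, 0 <= f x) -> (forall x, 0 <= g x) ->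
  rsummable f -> rsummable g -> rsum (fun x => f x - g x) = rsum f - rsum g.
Proof.
move=> f0 g0 sf sg; rewrite (rsum_ge0E f0) (rsum_ge0E g0) /rsum.
transitivity (fine (esumT f - esumT g)%E).
  have nneg (k : V -> R) : (forall x, 0 <= k x) ->
    forall x, [set: V] x -> (0 <= (EFin \o k) x)%E.
    by move=> k0 x _; rewrite lee_fin.
  exact: (congr1 fine (esumB sf sg (nneg _ f0) (nneg _ g0))).
rewrite fineB // ge0_fin_numE ?esum_ge0 -?rsummable_esum // => x _;
  by rewrite lee_fin.
Qed.

Lemma rsum_addE f g : (forall x, 0 <= f x) -> (forall x, 0 <= g x) ->
  rsummable f -> rsummable g -> rsum (fun x => f x + g x) = rsum f + rsum g.
Proof.
move=> f0 g0 sf sg; rewrite !rsum_ge0E //; last by move=> x; rewrite addr_ge0.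
under eq_esum do rewrite EFinD.
rewrite esumD; try by move=> x _; rewrite lee_fin.
by rewrite fineD // ge0_fin_numE ?esum_ge0 -?rsummable_esum // => x _;
  rewrite lee_fin.
Qed.

(** Positive and negative parts, written with the absolute value so that identities between them are
    field identities. *)
Let pos f x := (`|f x| + f x) / 2.
Let neg f x := (`|f x| - f x) / 2.

Let pos_ge0 f x : 0 <= pos f x.
Proof. by rewrite divr_ge0 // -lerBlDr sub0r -normrN ler_norm. Qed.

Let neg_ge0 f x : 0 <= neg f x.
Proof. by rewrite divr_ge0 // subr_ge0 ler_norm. Qed.

Let posnegE f x : pos f x - neg f x = f x.
Proof. by rewrite /pos /neg; field. Qed.

Let posneg f : (fun x => pos f x - neg f x) = f.
Proof. by apply/funext => x; rewrite posnegE. Qed.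

Lemma rsummable_norm f : rsummable (fun x => `|f x|) = rsummable f.
Proof.
rewrite /rsummable /summable; congr (_ < _)%E; apply: eq_esum => x _ /=.
by rewrite normr_id.
Qed.

Let summ_pos f : rsummable f -> rsummable (pos f).
Proof.
rewrite -rsummable_norm; apply: le_rsummable => x; rewrite ger0_norm //.
by rewrite ler_pdivrMr // mulr2n mulrDr mulr1 lerD // ler_norm.
Qed.

Let summ_neg f : rsummable f -> rsummable (neg f).
Proof.
rewrite -rsummable_norm; apply: le_rsummable => x; rewrite ger0_norm //.
by rewrite ler_pdivrMr // mulr2n mulrDr mulr1 lerD // -normrN ler_norm.
Qed.

Lemma rsumD f g : rsummable f -> rsummable g ->
  rsum (fun x => f x + g x) = rsum f + rsum g.
Proof.
move=> sf sg.
have -> : (fun x => f x + g x) =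
    (fun x => (pos f x + pos g x) - (neg f x + neg g x)).
  apply/funext => x; rewrite opprD addrACA.
  by rewrite !posnegE.
rewrite rsum_subE; try by move=> x; rewrite addr_ge0.
- rewrite !rsum_addE ?summ_pos ?summ_neg //.
  rewrite -[in RHS](posneg f) -[in RHS](posneg g).
  rewrite !rsum_subE ?summ_pos ?summ_neg //; ring.
- by apply: rsummableD; apply: summ_pos.
- by apply: rsummableD; apply: summ_neg.
Qed.

Lemma rsumN f : rsummable f -> rsum (fun x => - f x) = - rsum f.
Proof.
move=> sf; rewrite -[in RHS](posneg f).
have -> : (fun x => - f x) = (fun x => neg f x - pos f x).
  by apply/funext => x; rewrite -posnegE opprB.
by rewrite !rsum_subE ?summ_pos ?summ_neg // opprB.
Qed.

Lemma rsumZ (a : R) f : rsummable f -> rsum (fun x => a * f x) = a * rsum f.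
Proof.
wlog a0 : a / 0 <= a => [hw sf|sf].
  have [/hw->//|/ltW a0] := leP 0 a.
  rewrite -[LHS]opprK -rsumN; last exact: rsummableZ.
  have -> : (fun x => - (a * f x)) = (fun x => - a * f x).
    by apply/funext => x; rewrite mulNr.
  by rewrite hw ?oppr_ge0 // mulNr opprK.
have h k : (forall x, 0 <= k x) -> rsummable k ->
    rsum (fun x => a * k x) = a * rsum k.
  move=> k0 sk; rewrite !rsum_ge0E // => [|x]; last by rewrite mulr_ge0.
  rewrite esumZ // fineM // ge0_fin_numE -?rsummable_esum //.
  by rewrite esum_ge0 // => x _; rewrite lee_fin.
rewrite -[in RHS](posneg f) rsum_subE ?summ_pos ?summ_neg // mulrBr.
rewrite -!h ?summ_pos ?summ_neg // -rsum_subE ?rsummableZ ?summ_pos ?summ_neg //.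
- congr rsum; apply/funext => x.
  by rewrite -mulrBr posnegE.
- by move=> x; rewrite mulr_ge0.
- by move=> x; rewrite mulr_ge0.
Qed.

Lemma rsum_ge_seq f (s : seq V) : (forall x, 0 <= f x) -> rsummable f ->
  uniq s -> \sum_(x <- s) f x <= rsum f.
Proof.
move=> f0 sf us; rewrite rsum_ge0E // -lee_fin fineK; last first.
  rewrite ge0_fin_numE -?rsummable_esum //.
  by rewrite esum_ge0 // => x _; rewrite lee_fin.
apply: esum_ge; exists [set` s].
  by split => //; exact: finite_seq.
by rewrite -sumEFin fsbig_seq.
Qed.

Let mem_set1 (x y : V) : (x \in [set y]) = (x == y).
Proof. by apply/idP/eqP; rewrite inE. Qed.

Lemma rsummable_eq (y : V) f : rsummable (fun x => if x == y then f x else 0).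
Proof.
rewrite -rsummable_norm rsummable_esum // (eq_esum
  (b := fun x => if x \in [set y] then `|f x|%:E else 0%E)); last first.
  by move=> x _; rewrite mem_set1; case: ifP => //; rewrite normr0.
by rewrite -esum_mkcond esum_set1 ?lee_fin // ltry.
Qed.

Lemma rsum_eq (y : V) (c : R) : rsum (fun x => if x == y then c else 0) = c.
Proof.
have one : rsum (fun x => if x == y then 1 else 0 : R) = 1.
  rewrite rsum_ge0E; last by move=> x; case: ifP.
  rewrite (eq_esum (b := fun x => if x \in [set y] then 1%E else 0%E)).
    by rewrite -esum_mkcond esum_set1 ?lee_fin.
  by move=> x _; rewrite mem_set1; case: ifP.
rewrite -[RHS]mulr1 -one -rsumZ; last exact: rsummable_eq.
by congr rsum; apply/funext => x; case: ifP; rewrite ?mulr1 ?mulr0.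
Qed.

Lemma esum_bijective (phi : V -> V) (f : V -> \bar R) : bijective phi ->
  (\esum_(x in [set: V]) f (phi x) = \esum_(x in [set: V]) f x)%E.
Proof.
by move=> bphi; apply/esym/reindex_esum; rewrite setTT_bijective.
Qed.

Lemma rsum_bijective (phi : V -> V) f : bijective phi ->
  rsum (fun x => f (phi x)) = rsum f.
Proof.
move=> bphi; rewrite /rsum; congr (fine (_ - _)).
  by rewrite -[RHS](esum_bijective _ bphi); apply: eq_esum => x _; rewrite funepos.unlock.
by rewrite -[RHS](esum_bijective _ bphi); apply: eq_esum => x _; rewrite funeneg.unlock.
Qed.

End RealSums.

(** * Double counting of edges and the adjacency operator *)

Section Adjacency.
Variables (R : realType) (V : choiceType) (e : rel V) (d : nat).
Hypothesis simple_e : simple_graph e.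
Hypothesis degree_e : regular_graph e d.
Implicit Types (u v : V -> R) (h : V -> V -> R).

(** Both sides are sums over the oriented edges, which reversal permutes. *)
Lemma esum_nbrs_sym h : (forall x y, 0 <= h x y) ->
  (\esum_(x in [set: V]) (\sum_(y <- nbrs e x) h x y)%:E =
   \esum_(x in [set: V]) (\sum_(y <- nbrs e x) h y x)%:E)%E.
Proof.
move=> h0.
have pairs (k : V -> V -> R) : (forall x y, 0 <= k x y) ->
    (\esum_(x in [set: V]) (\sum_(y <- nbrs e x) k x y)%:E =
     \esum_(p in [set: V] `*`` (fun x => [set y | e x y])) (k p.1 p.2)%:E)%E.
  move=> k0; rewrite -(esum_esum (a := fun x y => (k x y)%:E)); last first.
    by move=> x y _ _; rewrite lee_fin.
  apply: eq_esum => x _; rewrite esum_fset; last 2 first.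
  - exact: finite_nbrs degree_e x.
  - by move=> y _; rewrite lee_fin.
  by rewrite (big_nbrs degree_e) -sumEFin.
rewrite !pairs //; apply: (reindex_esum _ _ (fun p : V * V => (p.2, p.1))).
split=> [[x y] [_ /= xy]|[x y] [x' y'] _ _ [-> ->] //|[x y] [_ /= xy]].
  by split => //=; rewrite simple_e.1.
by exists (y, x) => //; split => //=; rewrite simple_e.1.
Qed.

Lemma rsummable_nbrs_sym h : (forall x y, 0 <= h x y) ->
  rsummable (fun x => \sum_(y <- nbrs e x) h x y) =
  rsummable (fun x => \sum_(y <- nbrs e x) h y x).
Proof.
move=> h0; rewrite !rsummable_esum; try by move=> x; exact: sumr_ge0.
by rewrite (esum_nbrs_sym h0).
Qed.

Lemma rsum_nbrs_sym h : rsummable (fun x => \sum_(y <- nbrs e x) `|h x y|) ->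
  rsum (fun x => \sum_(y <- nbrs e x) h x y) =
  rsum (fun x => \sum_(y <- nbrs e x) h y x).
Proof.
move=> sh.
(* Signed weights reduce to nonnegative ones through h = (p - n)/2, both [p] and [n] being at most 2
   |h|. *)
pose p x y := `|h x y| + h x y; pose n x y := `|h x y| - h x y.
have p0 x y : 0 <= p x y by rewrite /p -lerBlDr sub0r -normrN ler_norm.
have n0 x y : 0 <= n x y by rewrite /n subr_ge0 ler_norm.
have sum_ge0 (k : V -> V -> R) x : (forall x y, 0 <= k x y) ->
  0 <= \sum_(y <- nbrs e x) k x y by move=> k0; exact: sumr_ge0.
have dom (k : V -> V -> R) : (forall x y, 0 <= k x y) ->
    (forall x y, k x y <= 2 * `|h x y|) ->
    rsummable (fun x => \sum_(y <- nbrs e x) k x y).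
  move=> k0 kh; apply: le_rsummable (rsummableZ 2 sh) => x.
  by rewrite ger0_norm ?sum_ge0 // mulr_sumr; apply: ler_sum.
have sp : rsummable (fun x => \sum_(y <- nbrs e x) p x y).
  apply: dom => // x y; rewrite /p; have := ler_norm (h x y); lra.
have sn : rsummable (fun x => \sum_(y <- nbrs e x) n x y).
  by apply: dom => // x y; rewrite /n; have := ler_norm (- h x y);
    rewrite normrN; lra.
have split_sum (k q r : V -> V -> R) :
    (forall x y, 0 <= q x y) -> (forall x y, 0 <= r x y) ->
    (forall x y, k x y = 2^-1 * (q x y - r x y)) ->
    rsummable (fun x => \sum_(y <- nbrs e x) q x y) ->
    rsummable (fun x => \sum_(y <- nbrs e x) r x y) ->
    rsum (fun x => \sum_(y <- nbrs e x) k x y) =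
    2^-1 * (rsum (fun x => \sum_(y <- nbrs e x) q x y) -
            rsum (fun x => \sum_(y <- nbrs e x) r x y)).
  move=> q0 r0 kE sq sr.
  rewrite -rsum_subE //; try by move=> x; exact: sum_ge0.
  rewrite -rsumZ; last exact: rsummableB.
  congr rsum; apply/funext => x.
  by rewrite -sumrB mulr_sumr; apply: eq_bigr => y _.
rewrite (split_sum h p n) // => [|x y]; last by rewrite /p /n; field.
rewrite (split_sum (fun x y => h y x) (fun x y => p y x) (fun x y => n y x)) //.
- congr (_ * (_ - _)).
    rewrite !rsum_ge0E; try by move=> x; exact: sumr_ge0.
    by rewrite (esum_nbrs_sym p0).
  rewrite !rsum_ge0E; try by move=> x; exact: sumr_ge0.
  by rewrite (esum_nbrs_sym n0).
- by move=> x y; rewrite /p /n; field.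
- by rewrite -rsummable_nbrs_sym.
- by rewrite -rsummable_nbrs_sym.
Qed.

(** The square is expanded over pairs, with 2 a_i a_j <= a_i^2 + a_j^2. *)
Lemma sqr_sum_le (T : Type) (s : seq T) (a : T -> R) :
  (\sum_(i <- s) a i) ^+ 2 <= (size s)%:R * \sum_(i <- s) a i ^+ 2.
Proof.
rewrite expr2 big_distrlr /=.
apply: (@le_trans _ _ (\sum_(i <- s) \sum_(j <- s) 2^-1 * (a i ^+ 2 + a j ^+ 2))).
  apply: ler_sum => i _; apply: ler_sum => j _.
  have := sqr_ge0 (a i - a j); rewrite sqrrB => h; nra.
set Q := \sum_(i <- s) a i ^+ 2.
have inner i : \sum_(j <- s) 2^-1 * (a i ^+ 2 + a j ^+ 2) =
    2^-1 * ((size s)%:R * a i ^+ 2 + Q).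
  by rewrite -mulr_sumr big_split /= big_const_seq count_predT iter_addr_0 mulr_natl.
under eq_bigr do rewrite inner.
rewrite -mulr_sumr big_split /= -mulr_sumr big_const_seq count_predT iter_addr_0.
by rewrite -/Q -(mulr_natl Q) le_eqVlt; apply/orP; left; apply/eqP; field.
Qed.

Definition adj u x : R := \sum_(y <- nbrs e x) u y.

Definition sqsum u : bool := rsummable (fun x => u x ^+ 2).

Lemma sqsumM u v : sqsum u -> sqsum v -> rsummable (fun x => u x * v x).
Proof.
move=> su sv; apply: le_rsummable (rsummableD su sv) => x.
rewrite ler_norml; have := sqr_ge0 (u x - v x); have := sqr_ge0 (u x + v x).
by rewrite sqrrB sqrrD => h1 h2; apply/andP; split; nra.
Qed.

Lemma sqsum_linear (a : R) u v : sqsum u -> sqsum v ->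
  sqsum (fun x => a * u x + v x).
Proof.
move=> su sv.
apply: le_rsummable (rsummableD (rsummableZ (2 * a ^+ 2) su) (rsummableZ 2 sv)) => x.
rewrite ger0_norm ?sqr_ge0 //; have := sqr_ge0 (a * u x - v x).
by rewrite sqrrB sqrrD => h; nra.
Qed.

Let sum_const x (c : R) : \sum_(y <- nbrs e x) c = d%:R * c.
Proof.
by rewrite big_const_seq count_predT iter_addr_0 (size_nbrs degree_e) mulr_natl.
Qed.

(** After reversal of the edges, each value of [u] is counted once per neighbour, that is d
    times. *)
Lemma rsummable_nbrs (u : V -> R) : (forall x, 0 <= u x) -> rsummable u ->
  rsummable (fun x => \sum_(y <- nbrs e x) u y).
Proof.
move=> u0 su; rewrite (@rsummable_nbrs_sym (fun x y => u y)) //.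
by under eq_fun do rewrite sum_const; exact: rsummableZ.
Qed.

Lemma rsum_nbrs (u : V -> R) : (forall x, 0 <= u x) -> rsummable u ->
  rsum (fun x => \sum_(y <- nbrs e x) u y) = d%:R * rsum u.
Proof.
move=> u0 su; rewrite (@rsum_nbrs_sym (fun x y => u y)); last first.
  by under eq_fun do under eq_bigr do rewrite ger0_norm //; exact: rsummable_nbrs.
by under eq_fun do rewrite sum_const; exact: rsumZ.
Qed.

Lemma sqsum_adj u : sqsum u -> sqsum (adj u).
Proof.
move=> su; apply: le_rsummable (rsummableZ d%:R (rsummable_nbrs _ su)) => [x|x].
  rewrite ger0_norm ?sqr_ge0 //; apply: le_trans (sqr_sum_le _ _) _.
  by rewrite (size_nbrs degree_e).
exact: sqr_ge0.
Qed.

(** Edge reversal for the weight u(y) v(x), absolutely summable because it is dominated by u(y)^2 +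
    v(x)^2. *)
Lemma rsum_adj_sym u v : sqsum u -> sqsum v ->
  rsum (fun x => adj u x * v x) = rsum (fun x => u x * adj v x).
Proof.
move=> su sv; under eq_fun do rewrite /adj mulr_suml.
rewrite (@rsum_nbrs_sym (fun x y => u y * v x)).
  by congr rsum; apply/funext => x; rewrite mulr_sumr.
apply: (@le_rsummable _ _ _
  (fun x => \sum_(y <- nbrs e x) u y ^+ 2 + d%:R * v x ^+ 2)); last first.
  apply: rsummableD; last exact: rsummableZ.
  by apply: (@rsummable_nbrs (fun y => u y ^+ 2)) => // x; exact: sqr_ge0.
move=> x; rewrite ger0_norm ?sumr_ge0 // -(sum_const x) -big_split /=.
apply: ler_sum => y _; rewrite ler_norml.
have := sqr_ge0 (u y - v x); have := sqr_ge0 (u y + v x).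
by rewrite sqrrB sqrrD => h1 h2; apply/andP; split; nra.
Qed.

(* This is half the sum of (u x + u y)^2 over the oriented edges. *)
Lemma rsum_signless_ge0 u : sqsum u ->
  0 <= d%:R * rsum (fun x => u x ^+ 2) + rsum (fun x => adj u x * u x).
Proof.
move=> su; have su2 := rsummable_nbrs (fun x => sqr_ge0 (u x)) su.
have sau := sqsumM (sqsum_adj su) su.
have : 0 <= rsum (fun x => \sum_(y <- nbrs e x) (u x + u y) ^+ 2).
  by apply: rsum_ge0 => x; apply: sumr_ge0 => y _; exact: sqr_ge0.
have -> : (fun x => \sum_(y <- nbrs e x) (u x + u y) ^+ 2) =
    (fun x => (d%:R * u x ^+ 2 + 2 * (adj u x * u x)) +
              \sum_(y <- nbrs e x) u y ^+ 2).
  apply/funext => x.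
  under eq_bigr do rewrite sqrrD -mulr_natl.
  by rewrite !big_split /= sum_const -!mulr_sumr (mulrC (adj u x)).
have sd := rsummableZ d%:R su; have s2 := rsummableZ 2 sau.
rewrite rsumD //; last exact: rsummableD.
rewrite rsumD // !rsumZ // rsum_nbrs // => [h|x]; last exact: sqr_ge0.
by lra.
Qed.

End Adjacency.

Section ComplexParts.
Variable R : realType.
Implicit Types (z w : R[i]).

Lemma ReD z w : complex.Re (z + w) = complex.Re z + complex.Re w.
Proof. by case: z w => [? ?] [? ?]. Qed.

Lemma ImD z w : complex.Im (z + w) = complex.Im z + complex.Im w.
Proof. by case: z w => [? ?] [? ?]. Qed.

Lemma Re_realM (a : R) z : complex.Re (a%:C%C * z) = a * complex.Re z.
Proof. by case: z => x y /=; rewrite mul0r subr0. Qed.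

Lemma Im_realM (a : R) z : complex.Im (a%:C%C * z) = a * complex.Im z.
Proof. by case: z => x y /=; rewrite mul0r addr0. Qed.

Lemma Re_sum (I : Type) (s : seq I) (F : I -> R[i]) :
  complex.Re (\sum_(i <- s) F i) = \sum_(i <- s) complex.Re (F i).
Proof. exact: (big_morph _ ReD). Qed.

Lemma Im_sum (I : Type) (s : seq I) (F : I -> R[i]) :
  complex.Im (\sum_(i <- s) F i) = \sum_(i <- s) complex.Im (F i).
Proof. exact: (big_morph _ ImD). Qed.

Lemma natC n : (n%:R : R[i]) = (n%:R : R)%:C%C.
Proof. by rewrite (rmorph_nat (real_complex R)). Qed.

Lemma natCV n : (n%:R : R[i])^-1 = ((n%:R : R)^-1)%:C%C.
Proof. by rewrite natC (fmorphV (real_complex R)). Qed.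

End ComplexParts.

(** * The real inner product space underlying l^2(V, d) *)

Section L2Space.
Variables (R : realType) (V : choiceType) (d : nat).
Implicit Types (f g : V -> R[i]).

Definition re f x : R := complex.Re (f x).
Definition im f x : R := complex.Im (f x).

Lemma l2_rsummable f :
  l2 d f = rsummable (fun x => d%:R * (re f x ^+ 2 + im f x ^+ 2)) :> Prop.
Proof.
by rewrite rsummable_esum // => x; rewrite mulr_ge0 // addr_ge0 ?sqr_ge0.
Qed.

Lemma l2_sqsum f : (0 < d)%N -> l2 d f <-> sqsum (re f) /\ sqsum (im f).
Proof.
move=> d0; rewrite l2_rsummable; split=> [sf|[sr si]]; last first.
  by apply: rsummableZ; apply: rsummableD.
have d1 : 1 <= d%:R :> R by rewrite (ler_nat R 1).
split; apply: le_rsummable sf => x; rewrite ger0_norm ?sqr_ge0 //.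
- apply: (@le_trans _ _ (re f x ^+ 2 + im f x ^+ 2)).
    by rewrite lerDl sqr_ge0.
  by rewrite ler_peMl // addr_ge0 ?sqr_ge0.
- apply: (@le_trans _ _ (re f x ^+ 2 + im f x ^+ 2)).
    by rewrite lerDr sqr_ge0.
  by rewrite ler_peMl // addr_ge0 ?sqr_ge0.
Qed.

(** [Rcomplex R] is R[i] with real scalars, so that a real vector space is obtained, as [inner_form]
    requires. *)
Definition l2pred : {pred V -> Rcomplex R} := fun f => `[< l2 d f >].

Lemma re_linear (a : R) (f g : V -> Rcomplex R) x :
  re (a *: f + g) x = a * re f x + re g x.
Proof.
rewrite /re (_ : (a *: f + g) x = a *: f x + g x) //.
by case: (f x) (g x) => [? ?] [? ?].
Qed.

Lemma im_linear (a : R) (f g : V -> Rcomplex R) x :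
  im (a *: f + g) x = a * im f x + im g x.
Proof.
rewrite /im (_ : (a *: f + g) x = a *: f x + g x) //.
by case: (f x) (g x) => [? ?] [? ?].
Qed.

Fact l2_submod_closed : submod_closed l2pred.
Proof.
split=> [|a f g]; first by
  apply/asboolP; rewrite l2_rsummable; apply: (@le_rsummable _ _ _ (fun=> 0));
  [move=> x; rewrite /re /im /= expr0n /= addr0 mulr0 normr0
  |rewrite rsummable_esum // esum1].
move=> /asboolP; rewrite l2_rsummable => sf /asboolP; rewrite l2_rsummable => sg.
apply/asboolP; rewrite l2_rsummable.
(* Pointwise, |a f + g|^2 <= 2 a^2 |f|^2 + 2 |g|^2. *)
apply: le_rsummable (rsummableD (rsummableZ (2 * a ^+ 2) sf) (rsummableZ 2 sg)) => x.
rewrite ger0_norm ?mulr_ge0 ?addr_ge0 ?sqr_ge0 //.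
rewrite (mulrCA _ d%:R) (mulrCA 2 d%:R) -mulrDr ler_wpM2l //.
rewrite re_linear im_linear.
have := sqr_ge0 (a * re f x - re g x); have := sqr_ge0 (a * im f x - im g x).
by rewrite !sqrrB !sqrrD => h1 h2; nra.
Qed.

HB.instance Definition _ :=
  GRing.isSubmodClosed.Build R (V -> Rcomplex R) l2pred l2_submod_closed.

Record l2space := L2Space { l2fun : V -> Rcomplex R; _ : l2fun \in l2pred }.
HB.instance Definition _ := [isSub for l2fun].
HB.instance Definition _ := [Choice of l2space by <:].
HB.instance Definition _ := [SubChoice_isSubLmodule of l2space by <:].

Definition l2form (f g : l2space) : R := complex.Re (inner d (l2fun f) (l2fun g)).

Lemma l2funP (f : l2space) : l2 d (l2fun f).
Proof. by apply/asboolP; exact: (valP f). Qed.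

Definition mk_l2 f (fl2 : l2 d f) : l2space :=
  @L2Space (f : V -> Rcomplex R) (asboolT fl2).

Hypothesis d_gt0 : (0 < d)%N.

Lemma l2_re (f : l2space) : sqsum (re (l2fun f)).
Proof. by have /(l2_sqsum _ d_gt0)[] := l2funP f. Qed.

Lemma l2_im (f : l2space) : sqsum (im (l2fun f)).
Proof. by have /(l2_sqsum _ d_gt0)[] := l2funP f. Qed.

Lemma l2formE (f g : l2space) : l2form f g =
  d%:R * (rsum (fun x => re (l2fun f) x * re (l2fun g) x) +
          rsum (fun x => im (l2fun f) x * im (l2fun g) x)).
Proof.
have srr := sqsumM (l2_re f) (l2_re g).
have sii := sqsumM (l2_im f) (l2_im g).
rewrite -rsumD // -rsumZ; last exact: rsummableD.
rewrite /l2form /inner /csum /=; congr rsum; apply/funext => x.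
rewrite natC -mulrA Re_realM; congr (_ * _); rewrite /re /im.
by case: (l2fun f x) (l2fun g x) => [? ?] [? ?] /=; rewrite mulrN opprK.
Qed.

Lemma l2form_inner : inner_form l2form.
Proof.
have d0 : 0 < d%:R :> R by rewrite ltr0n.
split=> [f g|a f g h|f|f f0].
- rewrite !l2formE; congr (_ * (_ + _)); congr rsum; apply/funext => x;
    exact: mulrC.
- have lin (u v w : V -> R) : sqsum u -> sqsum v -> sqsum w ->
      rsum (fun x => (a * u x + v x) * w x) =
      a * rsum (fun x => u x * w x) + rsum (fun x => v x * w x).
    move=> su sv sw; have suw := sqsumM su sw; have svw := sqsumM sv sw.
    rewrite -rsumZ // -rsumD ?rsummableZ //; congr rsum; apply/funext => x.
    by rewrite mulrDl mulrA.
  rewrite !l2formE.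
  have -> : re (l2fun (a *: f + g)) =
      (fun x => a * re (l2fun f) x + re (l2fun g) x).
    by apply/funext => x; rewrite -re_linear.
  have -> : im (l2fun (a *: f + g)) =
      (fun x => a * im (l2fun f) x + im (l2fun g) x).
    by apply/funext => x; rewrite -im_linear.
  by rewrite !lin ?l2_re ?l2_im //; ring.
- rewrite l2formE mulr_ge0 // addr_ge0 //; apply: rsum_ge0 => x;
    by rewrite -expr2 sqr_ge0.
move: f0; rewrite l2formE => /eqP; rewrite mulf_eq0 gt_eqF //= => /eqP f0.
have sq_ge0 (u : V -> R) x : 0 <= u x * u x by rewrite -expr2 sqr_ge0.
have sum0 (u v : V -> R) : sqsum u ->
    rsum (fun x => u x * u x) + rsum (fun x => v x * v x) = 0 -> forall x, u x = 0.
  move=> su uv x; apply/eqP; rewrite -sqrf_eq0 expr2 eq_le sq_ge0 andbT.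
  have := rsum_ge_seq (sq_ge0 u) (sqsumM su su) (s := [:: x]) isT.
  rewrite big_seq1; have := rsum_ge0 (sq_ge0 v) => h1 h2; lra.
apply/val_inj/funext => x; have := sum0 _ _ (l2_re f) f0 x.
rewrite addrC in f0; have := sum0 _ _ (l2_im f) f0 x.
rewrite /re /im /=; case: (l2fun f x) => p q /= -> ->.
by [].
Qed.

Lemma unit_vertex_l2 (y : V) : l2 d (@unit_vertex R V d y).
Proof.
apply/(l2_sqsum _ d_gt0); rewrite /sqsum; split.
  apply: (@le_rsummable _ _ _ (fun x => if x == y then (d%:R : R)^-1 else 0)).
    move=> x; rewrite /re /unit_vertex; case: ifP => _ /=.
      by rewrite ger0_norm ?sqr_ge0 // exprVn sqr_sqrtr.
    by rewrite expr0n /= normr0.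
  exact: rsummable_eq.
apply: (@le_rsummable _ _ _ (fun x => if x == y then 0 : R else 0)).
  by move=> x; rewrite /im /unit_vertex; case: ifP => _ /=; rewrite expr0n /= normr0.
exact: rsummable_eq.
Qed.

Definition unit_l2 y : l2space := mk_l2 (unit_vertex_l2 y).

(** The weight d against the normalization 1/sqrt d leaves sqrt d; pairing with a real vector sees
    only the real part. *)
Lemma l2form_unit (f : l2space) y :
  l2form f (unit_l2 y) = Num.sqrt d%:R * re (l2fun f) y.
Proof.
rewrite l2formE.
have -> : (fun x => re (l2fun f) x * re (l2fun (unit_l2 y)) x) =
    (fun x => if x == y then re (l2fun f) y * (Num.sqrt (d%:R : R))^-1 else 0).
  apply/funext => x; rewrite /= [re (unit_vertex _ _ _) x]/re /unit_vertex.
  by case: eqP => [->//|_] /=; rewrite mulr0.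
have -> : (fun x => im (l2fun f) x * im (l2fun (unit_l2 y)) x) =
    (fun x => if x == y then 0 else 0).
  apply/funext => x; rewrite /= [im (unit_vertex _ _ _) x]/im /unit_vertex.
  by case: eqP => [->//|_] /=; rewrite mulr0.
rewrite !rsum_eq addr0 mulrCA mulrC; congr (_ * _).
have s0 : Num.sqrt (d%:R : R) != 0 by rewrite sqrtr_eq0 -ltNge ltr0n.
by rewrite -{1}(@sqr_sqrtr R d%:R) // expr2 mulfK.
Qed.

(** By [l2form_unit] the left side is d times a finite partial sum of (Re f)^2. *)
Lemma Bessel_unit (f : l2space) (s : seq V) : uniq s ->
  \sum_(y <- s) l2form f (unit_l2 y) ^+ 2 <= l2form f f.
Proof.
move=> us; under eq_bigr do rewrite l2form_unit exprMn sqr_sqrtr //.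
rewrite -mulr_sumr l2formE ler_wpM2l //.
have sq_ge0 (u : V -> R) x : 0 <= u x * u x by rewrite -expr2 sqr_ge0.
apply: (@le_trans _ _ (rsum (fun x => re (l2fun f) x * re (l2fun f) x))).
  under eq_bigr do rewrite expr2.
  by apply: rsum_ge_seq => //; exact: sqsumM (l2_re f) (l2_re f).
by rewrite lerDl; apply: rsum_ge0.
Qed.

End L2Space.

(** * The operator Q *)

Section SignlessLaplacian.
Variables (R : realType) (V : choiceType) (e : rel V) (d : nat).
Hypothesis simple_e : simple_graph e.
Hypothesis degree_e : regular_graph e d.
Hypothesis d_gt0 : (0 < d)%N.

Local Notation H := (l2space R V d).
Local Notation Q := (@Qop R V e d).
Local Notation B := (@l2form R V d).

Lemma re_Qop (f : V -> R[i]) :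
  re (Q f) = (fun x => d%:R^-1 * adj e (re f) x + re f x).
Proof.
apply/funext => x; rewrite /re /Qop /transition_op ReD addrC natCV Re_realM.
by rewrite (big_nbrs degree_e) Re_sum.
Qed.

Lemma im_Qop (f : V -> R[i]) :
  im (Q f) = (fun x => d%:R^-1 * adj e (im f) x + im f x).
Proof.
apply/funext => x; rewrite /im /Qop /transition_op ImD addrC natCV Im_realM.
by rewrite (big_nbrs degree_e) Im_sum.
Qed.

Lemma Qop_l2 (f : H) : l2 d (Q (l2fun f)).
Proof.
apply/(l2_sqsum _ d_gt0); rewrite re_Qop im_Qop.
by split; apply: sqsum_linear; rewrite ?(sqsum_adj simple_e degree_e) ?l2_re ?l2_im.
Qed.

Definition qop (f : H) : H := mk_l2 (Qop_l2 f).

Lemma qopE (f : H) : l2fun (qop f) = Q (l2fun f). Proof. by []. Qed.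

Let dVK : (d%:R * d%:R^-1 = 1 :> R).
Proof. by rewrite divff // pnatr_eq0 -lt0n. Qed.

Let rsum_Qop (u v : V -> R) : sqsum u -> sqsum v ->
  d%:R * rsum (fun x => (d%:R^-1 * adj e u x + u x) * v x) =
  rsum (fun x => adj e u x * v x) + d%:R * rsum (fun x => u x * v x).
Proof.
move=> su sv; have sau := sqsum_adj simple_e degree_e su.
have -> : (fun x => (d%:R^-1 * adj e u x + u x) * v x) =
    (fun x => d%:R^-1 * (adj e u x * v x) + u x * v x).
  by apply/funext => x; rewrite mulrDl mulrA.
rewrite rsumD ?rsummableZ ?sqsumM // rsumZ ?sqsumM //.
by rewrite mulrDr mulrA dVK mul1r.
Qed.

Lemma form_qop (f g : H) : B (qop f) g =
  (rsum (fun x => adj e (re (l2fun f)) x * re (l2fun g) x) +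
   d%:R * rsum (fun x => re (l2fun f) x * re (l2fun g) x)) +
  (rsum (fun x => adj e (im (l2fun f)) x * im (l2fun g) x) +
   d%:R * rsum (fun x => im (l2fun f) x * im (l2fun g) x)).
Proof.
rewrite l2formE //= re_Qop im_Qop mulrDr.
rewrite (rsum_Qop (l2_re d_gt0 f) (l2_re d_gt0 g)).
by rewrite (rsum_Qop (l2_im d_gt0 f) (l2_im d_gt0 g)).
Qed.

Lemma qop_sym (f g : H) : B (qop f) g = B f (qop g).
Proof.
rewrite (form_sym (l2form_inner R V d_gt0) f) !form_qop.
rewrite (rsum_adj_sym simple_e degree_e (l2_re d_gt0 f) (l2_re d_gt0 g)).
rewrite (rsum_adj_sym simple_e degree_e (l2_im d_gt0 f) (l2_im d_gt0 g)).
by congr (_ + _ * _ + (_ + _ * _)); congr rsum; apply/funext => x;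
  exact: mulrC.
Qed.

(** The form splits into contributions of the real and imaginary parts, each a sum of squares over
    edges. *)
Lemma qop_ge0 (f : H) : 0 <= B (qop f) f.
Proof.
rewrite form_qop addr_ge0 // addrC.
  by apply: (rsum_signless_ge0 simple_e degree_e); exact: l2_re.
by apply: (rsum_signless_ge0 simple_e degree_e); exact: l2_im.
Qed.

Lemma l2fun_inj (f g : H) : l2fun f = l2fun g -> f = g.
Proof. exact: val_inj. Qed.

Lemma l2fun_linear (a : R) (f g : H) :
  l2fun (a *: f + g) = (fun x => a%:C%C * l2fun f x + l2fun g x) :> (V -> R[i]).
Proof.
apply/funext => x.
have -> : l2fun (a *: f + g) x = a *: l2fun f x + l2fun g x by [].
by case: (l2fun f x) (l2fun g x) => [? ?] [? ?] /=; apply/eqP;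
  rewrite eq_complex /= !mul0r subr0 addr0 !eqxx.
Qed.

Lemma qop_linear (a : R) (f g : H) : qop (a *: f + g) = a *: qop f + qop g.
Proof.
apply: l2fun_inj; rewrite [RHS]l2fun_linear !qopE l2fun_linear; apply/funext => x.
rewrite /Qop /transition_op !(big_nbrs degree_e) big_split /= -mulr_sumr.
by ring.
Qed.

(** * Automorphisms as isometries commuting with Q *)

Section Automorphism.
Variable phi : V -> V.
Hypothesis phi_aut : graph_automorphism e phi.

Lemma pullback_l2 (f : H) : l2 d (fun x => l2fun f (phi x)).
Proof.
rewrite /l2 (esum_bijective (fun x => (d%:R * (re (l2fun f) x ^+ 2 +
  im (l2fun f) x ^+ 2))%:E) phi_aut.1).
exact: l2funP.
Qed.

Definition pullback (f : H) : H := mk_l2 (pullback_l2 f).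

Lemma pullback_isometry (f g : H) : B (pullback f) (pullback g) = B f g.
Proof.
rewrite !l2formE //; congr (_ * (_ + _)).
  exact: (rsum_bijective (fun x => re (l2fun f) x * re (l2fun g) x) phi_aut.1).
exact: (rsum_bijective (fun x => im (l2fun f) x * im (l2fun g) x) phi_aut.1).
Qed.

Lemma pullback_qop (f : H) : pullback (qop f) = qop (pullback f).
Proof.
apply: l2fun_inj; apply/funext => x /=; rewrite /Qop /transition_op.
by rewrite !(big_nbrs degree_e) (big_nbrs_automorphism degree_e _ _ phi_aut).
Qed.

(** Composition with [phi] moves vertex vectors backwards. *)
Lemma pullback_unit y : pullback (unit_l2 R d_gt0 (phi y)) = unit_l2 R d_gt0 y.
Proof.
apply: l2fun_inj; apply/funext => x /=; rewrite /unit_vertex.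
by rewrite (inj_eq (bij_inj phi_aut.1)).
Qed.

End Automorphism.

(** * The given spectral measure, transported to the real space *)

Section SpectralMeasure.
Variable E : set R -> (V -> R[i]) -> V -> R[i].
Hypothesis hE : spectral_measure_of d Q E.

(** [E A] is known to preserve l^2 only for measurable [A]; the value 0 elsewhere is a default. *)
Definition eop (A : set (measurableTypeR R)) (f : H) : H :=
  match pselect (measurable A) with
  | left mA => mk_l2 (pvm_l2 hE.1 mA (l2funP f))
  | right _ => 0
  end.

Lemma eopE A f : measurable A -> l2fun (eop A f) = E A (l2fun f) :> (V -> R[i]).
Proof. by rewrite /eop; case: pselect. Qed.

Lemma form_eop A f : measurable A ->
  B (eop A f) f = complex.Re (inner d (E A (l2fun f)) (l2fun f)).
Proof. by move=> mA; rewrite /l2form eopE. Qed.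

Lemma eop_resolution : spectral_resolution B eop qop.
Proof.
have [pE intE] := hE.
split.
- move=> A a f g mA; apply: l2fun_inj; rewrite [RHS]l2fun_linear !eopE // l2fun_linear.
  by rewrite (pvm_linear pE) //; exact: l2funP.
- move=> A f g mA; rewrite /l2form !eopE //.
  by rewrite (pvm_selfadjoint pE) //; exact: l2funP.
- move=> A C f mA mC; apply: l2fun_inj => /=; rewrite !eopE //; last exact: measurableI.
  by rewrite (pvm_setI pE) //; exact: l2funP.
- by move=> f; apply: l2fun_inj => /=; rewrite eopE // (pvm_setT pE) //; exact: l2funP.
- move=> f; have [m mf] := pvm_sigma_additive pE (l2funP f).
  by exists m => A mA; rewrite form_eop // mf.
- exact: qop_linear.
- exact: qop_sym.
- exact: qop_ge0.
- move=> f m mf.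
  have [//|mi ef] := intE _ m (l2funP f).
    by move=> A mA; rewrite mf // form_eop.
  by split => //; rewrite /l2form qopE ef.
Qed.

End SpectralMeasure.
End SignlessLaplacian.

(** * The two bounds *)

Lemma vertex_spectral_bound (R : realType) (V : choiceType) (e : rel V) (d : nat)
    (E : set R -> (V -> R[i]) -> V -> R[i]) (x : V) (c delta : R) :
  simple_graph e -> connected_graph e -> vertex_transitive e ->
  regular_graph e d -> (0 < d)%N -> spectral_measure_of d (Qop e d) E ->
  0 < c < 1 -> 0 < delta ->
  vertex_spectral_measure d E x delta <=
    1 / (c ^+ 2 * (ball_card e x (Num.sqrt (1 - c) / Num.sqrt (d%:R * delta)))%:R).
Proof.
move=> simple_e connected_e transitive_e degree_e d_gt0 hE /andP[c_gt0 c_lt1] delta_gt0.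
pose B := @l2form R V d.
have hB : inner_form B := l2form_inner R V d_gt0.
have res : spectral_resolution B _ _ := eop_resolution simple_e degree_e d_gt0 hE.
pose A : set (measurableTypeR R) := [set` `[0, delta]].
have mA : measurable A by exact: measurable_itv.
pose u (y : V) := unit_l2 R d_gt0 y.
pose F y := eop hE A (u y).
pose mu := B (F x) (F x).
have EF y : eop hE A (F y) = F y by rewrite /F (res_idem res).
have BF y z : B (F y) (u z) = B (F y) (F z).
  by rewrite -{1}EF (res_sym res).
have muE y : B (F y) (F y) = B (F y) (u y) by rewrite BF.
have -> : vertex_spectral_measure d E x delta = mu.
  by rewrite /mu muE /B /F (form_eop hE _ mA).
(* Pullback along an automorphism taking z to y sends e_y to e_z; exchanging y and z then gives
   equality. *)
have F_le y z : B (F y) (F y) <= B (F z) (F z).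
  have [phi aut phi_zy] := transitive_e z y.
  have Uy : pullback aut (u y) = u z by rewrite /u -phi_zy pullback_unit.
  rewrite !muE /F -Uy.
  apply: (res_itv_isometry_le hB res) => //.
    exact: pullback_isometry.
  exact: pullback_qop.
have F_norm y : B (F y) (F y) = mu by apply/eqP; rewrite eq_le !F_le.
have F_energy y : d%:R * mu + \sum_(z <- nbrs e y) B (F y) (F z) <=
    d%:R * (delta * mu).
  have Q_le : B (qop simple_e degree_e d_gt0 (F y)) (F y) <= delta * mu.
    rewrite -(F_norm y); apply: (op_le hB res mA _ (EF y)) => t.
    by rewrite /A /= in_itv /= => /andP[].
  (* As Q commutes with the projection, the second [F y] may be replaced by e_y, which reads off the
     value of Q (F y) at y. *)
  have QFu : B (qop simple_e degree_e d_gt0 (F y)) (F y) =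
      B (qop simple_e degree_e d_gt0 (F y)) (u y).
    by rewrite -[in RHS](EF y) (op_res_comm hB res) // (res_sym res).
  suff h : d%:R * mu + \sum_(z <- nbrs e y) B (F y) (F z) =
      d%:R * B (qop simple_e degree_e d_gt0 (F y)) (F y).
    by rewrite h; apply: ler_wpM2l.
  have BFz z : B (F y) (F z) = Num.sqrt d%:R * re (l2fun (F y)) z.
    by rewrite -BF /B l2form_unit.
  under eq_bigr do rewrite BFz.
  rewrite QFu -(F_norm y) BFz /B /u l2form_unit qopE (re_Qop degree_e) /adj.
  have d0 : (d%:R : R) != 0 by rewrite pnatr_eq0 -lt0n.
  by rewrite -mulr_sumr; field.
pose r : R := Num.sqrt (1 - c) / Num.sqrt (d%:R * delta).
have dd0 : 0 < d%:R * delta by rewrite mulr_gt0 // ltr0n.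
have r0 : 0 <= r by rewrite divr_ge0 ?sqrtr_ge0.
pose S := enum_fset (fset_set [set v | (dist e v x)%:R <= r]).
have memS v : (v \in S) = ((dist e v x)%:R <= r).
  rewrite (in_fset_set (finite_ball simple_e connected_e degree_e x r)).
  by apply/idP/idP; rewrite inE.
have corr v : v \in S -> (c * mu) ^+ 2 <= B (F x) (u v) ^+ 2.
  rewrite memS => vr; have mu0 : 0 <= mu := form_ge0 hB _.
  rewrite BF -[leRHS]real_normK ?num_real // ler_pXn2r ?nnegrE ?mulr_ge0 ?(ltW c_gt0) //.
  have walk_xv := walk_sym simple_e (walk_dist connected_e v x).
  apply: le_trans _ (embedding_correlation hB degree_e F_norm F_energy (ltW delta_gt0) walk_xv).
  rewrite mulrC ler_wpM2l // lerBrDr -lerBrDl -ler_pdivlMr //.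
  (* The radius is chosen so that k <= r is equivalent to 1 - k^2 d delta >= c. *)
  have -> : (1 - c) / (d%:R * delta) = r ^+ 2.
    by rewrite /r expr_div_n !sqr_sqrtr ?ltW // subr_gt0.
  by rewrite ler_pXn2r ?nnegrE.
have NE : ball_card e x r = size S by [].
(* The ball contains its centre, so the denominator of the bound is positive. *)
have N0 : (0 < size S)%N.
  by rewrite -has_predT; apply/hasP; exists x; rewrite // memS distxx.
rewrite -/r NE.
have := Bessel_unit d_gt0 (F x) (fset_uniq (fset_set [set v | (dist e v x)%:R <= r])).
have /le_trans le_S : (size S)%:R * (c * mu) ^+ 2 <=
    \sum_(v <- S) B (F x) (u v) ^+ 2.
  have -> : (size S)%:R * (c * mu) ^+ 2 = \sum_(v <- S) (c * mu) ^+ 2.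
    by rewrite big_const_seq count_predT iter_addr_0 mulr_natl.
  by rewrite big_seq [leRHS]big_seq; apply: ler_sum.
move/le_S; rewrite -/mu => Nmu.
have cN0 : 0 < c ^+ 2 * (size S)%:R by rewrite mulr_gt0 ?exprn_gt0 ?ltr0n.
rewrite ler_pdivlMr //.
(* The bound N c^2 mu^2 <= mu is to be divided by mu, hence the separate case mu = 0. *)
have [->|mu_neq0] := eqVneq mu 0; first by rewrite mul0r.
have mu0 : 0 < mu by rewrite lt_neqAle eq_sym mu_neq0 (form_ge0 hB).
rewrite -(ler_pM2r mu0) mul1r; apply: le_trans Nmu.
by rewrite le_eqVlt; apply/orP; left; apply/eqP; ring.
Qed.

Lemma eigenvalue_bound (R : realType) (V : choiceType) (e : rel V) (d : nat)
    (lam : R) :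
  simple_graph e -> connected_graph e -> vertex_transitive e ->
  regular_graph e d -> ~ bipartite_graph e -> finite_set [set: V] ->
  eigenvalues d (Qop e d) lam ->
  2 / d%:R * (sin (pi / (4 * (diam e R + 1)))) ^+ 2 <= lam.
Proof.
move=> simple_e connected_e transitive_e degree_e nonbip finV [f [_ f_neq0 f_eigen]].
have d_gt0 := degree_gt0 degree_e nonbip.
(* Since [lam] is real, the real and imaginary parts of [f] satisfy the same equation, and one of
   them is nonzero at a point where [f] is. *)
have [g [z gz g_eigen]] : exists g : V -> R, exists2 z, g z != 0 &
    forall x, g x + d%:R^-1 * \sum_(y <- nbrs e x) g y = lam * g x.
  have [z fz] : exists z, f z != 0.
    apply: contrapT => none; apply: f_neq0; apply/funext => z.
    by apply/eqP/negPn/negP => fz; apply: none; exists z.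
  have re_eigen x : re f x + d%:R^-1 * \sum_(y <- nbrs e x) re f y = lam * re f x.
    by have := congr1 (fun h => re h x) f_eigen; rewrite (re_Qop degree_e) addrC => ->;
      rewrite {1}/re Re_realM.
  have im_eigen x : im f x + d%:R^-1 * \sum_(y <- nbrs e x) im f y = lam * im f x.
    by have := congr1 (fun h => im h x) f_eigen; rewrite (im_Qop degree_e) addrC => ->;
      rewrite {1}/im Im_realM.
  have [rz|rz] := eqVneq (re f z) 0; last by exists (re f), z.
  exists (im f), z => //; apply: contraNneq fz => iz.
  by move: rz iz; rewrite /re /im; case: (f z) => p q /= -> ->.
have [x [y [w [closed odd_k]]]] := odd_closed_walk simple_e connected_e nonbip.
set k := (_ + _).+1 in closed odd_k.
pose D := diam e R; pose t : R := pi / (4 * (D + 1)).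
have D0 : 0 <= D by apply: le_trans (dist_le_diam e R x y finV).
have D1 : 0 < D + 1 by rewrite ltr_wpDl.
have t0 : 0 < t by rewrite divr_gt0 ?pi_gt0 // mulr_gt0.
have tE : 4 * (D + 1) * t = pi by rewrite mulrC divfK // gt_eqF // mulr_gt0.
(* With k <= 2 D + 1 and theta = 2 t, the total angle k theta is at most pi - 2 t, strictly below
   pi. *)
have k_le : k%:R + 1 <= 2 * (D + 1).
  have h1 := dist_le_diam e R x y finV; have h2 := dist_le_diam e R x w finV.
  by rewrite /k -natr1 natrD -/D; rewrite -/D in h1 h2; lra.
have kt : k%:R * (t *+ 2) < pi by rewrite -tE mulr2n; nra.
have := eigenvalue_gt transitive_e degree_e d_gt0 finV g_eigen gz closed odd_k
  (mulrn_wge0 2 (ltW t0)) kt.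
(* By 1 - cos(2 t) = 2 sin(t)^2, the inequality just obtained is 2 sin(t)^2 < d lam. *)
rewrite cos_mulr2n sin2cos2 -/D -/t => h.
rewrite mulrAC ler_pdivrMr ?ltr0n // (mulrC lam); apply: le_trans (ltW h).
by rewrite mulr2n; lra.
Qed.

Theorem theorem1p5 (R : realType) (V : choiceType) (e : rel V) (d : nat)
    (simple_e : simple_graph e) (connected_e : connected_graph e)
    (transitive_e : vertex_transitive e) (degree_e : regular_graph e d)
    (nonbipartite_e : ~ bipartite_graph e) :
  (forall E : set R -> (V -> R[i]) -> V -> R[i],
     spectral_measure_of d (Qop e d) E ->
     forall (x : V) (c delta : R), 0 < c < 1 -> 0 < delta <= 2 ->
       vertex_spectral_measure d E x delta <=
         1 / (c ^+ 2 * (ball_card e x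
           (Num.sqrt (1 - c) / Num.sqrt (d%:R * delta)))%:R))
  /\
  (finite_set [set: V] ->
   forall lam_min : R, smallest_eigenvalue d (Qop e d) lam_min ->
     2 / d%:R * (sin (pi / (4 * (diam e R + 1)))) ^+ 2 <= lam_min).
Proof.
have d_gt0 := degree_gt0 degree_e nonbipartite_e.
split=> [E hE x c delta c01 /andP[delta_gt0 _]|finV lam_min [eig _]].
  exact: vertex_spectral_bound.
exact: eigenvalue_bound.
Qed.
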